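(* Assume (a) the no-premature-left-contact condition: for every finite $t\ge0$, $\sup_{0\le s\le t}Y_s<0$ on $\{\tau>t\}$; and (b) for every predictable stopping time $\sigma$, $\mathbb P(\{\sigma<\infty\}\cap\{X_{\sigma-}<b(\sigma)\le X_\sigma\})=0$. Define $A_t:=\mathbf 1_{\{\tau\le t\}}$, $A^L_t:=\mathbf 1_{\{\tau_L\le t\}}$, $A^G_t:=\mathbf 1_{\{\tau_G\le t\}}$, and let $\Lambda,\Lambda^L,\Lambda^G$ denote the dual predictable projections (predictable compensators) of $A,A^L,A^G$. Then $A=A^L+A^G$ and $\Lambda=\Lambda^L+\Lambda^G$. Moreover $\Lambda^L=A^L$, so $\Lambda^L$ is purely discontinuous with a single unit jump at $\tau_L$ on $L$, whereas $\Lambda^G$ is continuous.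
   Context: Let $(\Omega,\mathcal F,\mathbb F=(\mathcal F_t)_{t\ge0},\mathbb P)$ be a filtered probability space satisfying the usual conditions. Let $X$ be a càdlàg $\mathbb F$-adapted real-valued process and $b:[0,\infty)\to\mathbb R$ a continuous deterministic function, with $X_0<b(0)$ identically. For $t>0$, $Y_{t-}$, $X_{t-}$ denote left limits. Set $Y_t:=X_t-b(t)$ and $\tau:=\inf\{t\ge0: Y_t\ge 0\}$ (with $\inf\emptyset=\infty$). Let $L:=\{\tau<\infty,\,Y_{\tau-}=0\}$, $G:=\{\tau<\infty,\,Y_{\tau-}<0\}$; define $\tau_L:=\tau$ on $L$, $\tau_L:=\infty$ otherwise, and $\tau_G:=\tau$ on $G$, $\tau_G:=\infty$ otherwise. *)

(* Defs.v *)
From mathcomp Require Import all_boot all_algebra all_classical all_reals all_analysis.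
Import GRing.Theory Num.Theory.
Import numFieldNormedType.Exports.
Set Implicit Arguments. Unset Strict Implicit. Unset Printing Implicit Defensive.
Local Open Scope classical_set_scope.
Local Open Scope ring_scope.

Section processes.
Context {R : realType} {d : measure_display} {Omega : measurableType d}.
Implicit Types (P : probability Omega R) (F : R -> set (set Omega)).

Definition usual_filtration P F : Prop :=
  [/\ (forall t, 0 <= t -> sigma_algebra setT (F t)),
      (forall t A, 0 <= t -> F t A -> measurable A),
      (forall s t A, 0 <= s <= t -> F s A -> F t A),
      (forall t A, 0 <= t -> (forall s, t < s -> F s A) -> F t A) &
      (forall N, P.-negligible N -> F 0 N)].

(** Real-valued process X indexed by t >= 0 (values at t < 0 are irrelevant). *)
Definition adapted F (X : R -> Omega -> R) : Prop :=
  forall t, 0 <= t -> forall B : set R, measurable B ->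
    F t [set w | X t w \in B].

Definition cadlag (f : R -> R) : Prop :=
  forall t, 0 <= t ->
    f x @[x --> t^'+] --> f t /\ (0 < t -> cvg (f x @[x --> t^'-])).

Definition leftlim (f : R -> R) (t : R) : R :=
  if t <= 0 then f 0 else lim (f x @[x --> t^'-]).

Definition predictable_rectangles F : set (set (R * Omega)) :=
  [set C | (exists B, F 0 B /\ C = [set 0] `*` B) \/
           (exists s t B, [/\ 0 <= s, s < t, F s B & C = `]s, t] `*` B])].

Definition predictable_set F (C : set (R * Omega)) : Prop :=
  <<s predictable_rectangles F >> C.

Definition predictable F (H : R -> Omega -> R) : Prop :=
  forall B : set R, measurable B ->
    predictable_set F [set p | 0 <= p.1 /\ H p.1 p.2 \in B].

Definition predictable_time F (sigma : Omega -> \bar R) : Prop :=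
  (forall w, (0 <= sigma w)%E) /\
  predictable_set F [set p | 0 <= p.1 /\ (sigma p.2 <= p.1%:E)%E].

(** Lambda is the predictable compensator (dual predictable projection) of
    the integrable adapted increasing process A: Lambda is predictable,
    càdlàg, nondecreasing, Lambda_0 = 0, integrable, and A - Lambda is a
    martingale. *)
Definition compensator P F (A Lambda : R -> Omega -> R) : Prop :=
  [/\ predictable F Lambda /\ (forall w, Lambda 0 w = 0),
      (forall w, cadlag (Lambda ^~ w)),
      (forall w s t, 0 <= s <= t -> Lambda s w <= Lambda t w),
      (forall t, 0 <= t -> P.-integrable setT (fun w => (Lambda t w)%:E)) &
      (forall s t B, 0 <= s <= t -> F s B ->
         (\int[P]_(w in B) (A t w - Lambda t w)%:E =
          \int[P]_(w in B) (A s w - Lambda s w)%:E)%E)].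

Definition Yp (X : R -> Omega -> R) (b : R -> R) : R -> Omega -> R :=
  fun t w => X t w - b t.

Definition tau (X : R -> Omega -> R) (b : R -> R) (w : Omega) : \bar R :=
  ereal_inf [set t%:E | t in [set t : R | 0 <= t /\ 0 <= Yp X b t w]].

Definition Lset X b : set Omega :=
  [set w | (tau X b w < +oo)%E /\ leftlim (Yp X b ^~ w) (fine (tau X b w)) = 0].
Definition Gset X b : set Omega :=
  [set w | (tau X b w < +oo)%E /\ leftlim (Yp X b ^~ w) (fine (tau X b w)) < 0].

Definition tauL X b (w : Omega) : \bar R :=
  if `[< Lset X b w >] then tau X b w else +oo%E.
Definition tauG X b (w : Omega) : \bar R :=
  if `[< Gset X b w >] then tau X b w else +oo%E.

Definition ind_proc (sigma : Omega -> \bar R) : R -> Omega -> R :=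
  fun t w => ((sigma w <= t%:E)%E)%:R.

End processes.

(* Main.v *)
(** Integration against a right-continuous increasing process U is turned, by
    the time change u |-> inf {s | u <= U_s}, into integration against Lebesgue
    measure.  This gives the measure S |-> E[int_0^T 1_S(t, .) dU_t] on time x
    Omega, and two processes with the same conditional increments give the
    same mass to all predictable sets (pi-lambda theorem).

    Uniqueness of compensators: let M = U - V with U, V predictable increasing
    and phi convex.  Convexity gives phi(M_T) <= int_0^T phi'(M_s) dM_s
    pathwise, and the right-hand side has mean 0 because phi'(M) is
    predictable.  Hence E phi(M_T) <= 0 and M_T = 0 almost surely.

    By (a), tau_L <= t holds iff for every n some rational s < t satisfies
    s < tau and Y_s > -1/(n+1), so A^L is predictable and is its own
    compensator.

    A jump of Lambda^G at r happens at a level time rho_a = inf {t |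
    Lambda^G_t >= a} with a rational.  Since Lambda^G is predictable, rho_a
    is a predictable time and its graph a predictable set; by (b) the process
    A^G, hence also Lambda^G, puts no mass on that graph. *)

Require Import Defs.
From mathcomp Require Import all_boot all_order all_algebra all_classical all_reals all_analysis.
From mathcomp Require Import measurable_realfun lra ring.
Import Order.TTheory GRing.Theory Num.Theory.
Import numFieldNormedType.Exports.
Set Implicit Arguments. Unset Strict Implicit. Unset Printing Implicit Defensive.
Local Open Scope classical_set_scope.
Local Open Scope ring_scope.

(** * Predictable sets *)

Section filtration.
Context {R : realType} {d : measure_display} {Omega : measurableType d}.
Context {P : probability Omega R} {F : R -> set (set Omega)}.
Hypothesis HF : usual_filtration P F.

Lemma filtration_measurableE t : 0 <= t ->
  (measurable : set (set (g_sigma_algebraType (F t)))) = F t.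
Proof. by move=> t0; apply: sigma_algebra_id; case: HF => + _ _ _ _; exact. Qed.

Lemma filtrationC t A : 0 <= t -> F t A -> F t (~` A).
Proof. by move=> t0; rewrite -filtration_measurableE//; exact: measurableC. Qed.

Lemma filtrationU t A B : 0 <= t -> F t A -> F t B -> F t (A `|` B).
Proof. by move=> t0; rewrite -filtration_measurableE//; exact: measurableU. Qed.

Lemma filtrationI t A B : 0 <= t -> F t A -> F t B -> F t (A `&` B).
Proof. by move=> t0; rewrite -filtration_measurableE//; exact: measurableI. Qed.

Lemma filtration0 t : 0 <= t -> F t set0.
Proof. by move=> t0; rewrite -filtration_measurableE//; exact: measurable0. Qed.

Lemma filtrationT t : 0 <= t -> F t setT.
Proof. by move=> t0; rewrite -filtration_measurableE//; exact: measurableT. Qed.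

Lemma filtration_bigcup t (A : (set Omega)^nat) : 0 <= t ->
  (forall n, F t (A n)) -> F t (\bigcup_n A n).
Proof.
move=> t0; rewrite -filtration_measurableE// => mA.
by apply: bigcup_measurable => n _; exact: mA.
Qed.

Lemma filtration_bigcap t (A : (set Omega)^nat) : 0 <= t ->
  (forall n, F t (A n)) -> F t (\bigcap_n A n).
Proof.
move=> t0; rewrite -filtration_measurableE// => mA.
exact: bigcapT_measurable.
Qed.

Lemma filtration_bigcup_rat t (A : rat -> set Omega) : 0 <= t ->
  (forall q, F t (A q)) -> F t (\bigcup_q A q).
Proof.
move=> t0; rewrite -filtration_measurableE// => mA.
exact: bigcupT_measurable_rat.
Qed.

Lemma filtration_measurable t A : 0 <= t -> F t A -> measurable A.
Proof. by case: HF => _ + _ _ _; exact. Qed.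

Lemma filtration_le s t A : 0 <= s <= t -> F s A -> F t A.
Proof. by case: HF => _ _ + _ _; exact. Qed.

Local Notation predT := (g_sigma_algebraType (predictable_rectangles F)).

Lemma predictable_set_after (q : R) (B : set Omega) : 0 <= q -> F q B ->
  predictable_set F [set p | q < p.1 /\ B p.2].
Proof.
move=> q0 FB.
have -> : [set p | q < p.1 /\ B p.2] =
  \bigcup_n (`]q, q + n.+1%:R] `*` B : set (R * Omega)).
  apply/seteqP; split=> [[s w] /= [qs Bw]|[s w] /= [n _ []]] /=.
    exists (Num.trunc (s - q)) => //; split=> //=; rewrite in_itv/= qs/=.
    rewrite -lerBlDl ltW// truncnS_gt// subr_ge0 ltW//.
  by rewrite in_itv/= => /andP[].
apply: (@bigcup_measurable _ predT) => n _.
apply: sub_sigma_algebra; right; exists q, (q + n.+1%:R), B.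
by split=> //; rewrite ltrDl.
Qed.

Lemma predictable_set_ge0 : predictable_set F [set p | 0 <= p.1].
Proof.
have -> : [set p : R * Omega | 0 <= p.1] =
    ([set 0] `*` setT) `|` [set p | 0 < p.1 /\ setT p.2].
  apply/seteqP; split=> [[s w] /=|[s w] /= [[-> _]|[/ltW]]//].
  by rewrite le_eqVlt => /orP[/eqP <-|]; [left|right].
apply: (@measurableU _ predT).
  by apply: sub_sigma_algebra; left; exists setT; split=> //; exact: filtrationT.
by apply: predictable_set_after => //; exact: filtrationT.
Qed.

(** The sets whose section at [t] lies in [F t] form a sigma-algebra. A rectangle over []s, u]] has
    a nonempty section only when [s < t], and then [F s] is contained in [F t]. *)
Lemma predictable_set_section (C : set (R * Omega)) (t : R) : 0 <= t ->
  predictable_set F C -> F t [set w | C (t, w)].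
Proof.
move=> t0; apply: (@smallest_sub _ (sigma_algebra setT) _
  [set C | F t [set w | C (t, w)]]).
- split.
  + exact: filtration0.
  + move=> A /= /(filtrationC t0); congr F.
    by apply/seteqP; split=> w /=; [|case].
  + move=> A FA /=.
    have -> : [set w | (\bigcup_k A k) (t, w)] = \bigcup_k [set w | A k (t, w)].
      by apply/seteqP; split=> w.
    exact: filtration_bigcup.
- move=> _ [[B [FB ->]]|[s [u [B [s0 su FB ->]]]]] /=.
    have [->|t0'] := eqVneq t 0.
      by rewrite (_ : [set w | _] = B)//; apply/seteqP; split=> [w []|w].
    rewrite (_ : [set w | _] = set0); first exact: filtration0.
    by rewrite -subset0 => w [/eqP]; rewrite (negbTE t0').
  have [/andP[st tu]|h] := boolP (s < t <= u).
    rewrite (_ : [set w | _] = B); last first.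
      by apply/seteqP; split=> [w []|w Bw]//; split=> //=; rewrite in_itv/= st tu.
    by apply: filtration_le FB; rewrite s0 ltW.
  rewrite (_ : [set w | _] = set0); first exact: filtration0.
  by rewrite -subset0 => w [/=]; rewrite in_itv/= (negbTE h).
Qed.

Lemma predictable_set_measurable (C : set (R * Omega)) :
  predictable_set F C -> measurable C.
Proof.
apply: smallest_sub; first exact: sigma_algebra_measurable.
move=> _ [[B [FB ->]]|[s [u [B [s0 su FB ->]]]]]; apply: measurableX => //.
  exact: filtration_measurable FB.
exact: filtration_measurable FB.
Qed.

(** Makes the rectangles a pi-system. Disjoint rectangles cause no exception, because the empty set
    is itself a rectangle over [[set 0]]. *)
Lemma setI_closed_predictable_rectangles :
  setI_closed (predictable_rectangles F).
Proof.
have rect0 : predictable_rectangles F set0.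
  by left; exists set0; rewrite setX0; split=> //; exact: filtration0.
move=> _ _ [[B [FB ->]]|[s [u [B [s0 su FB ->]]]]]
  [[B' [FB' ->]]|[s' [u' [B' [s0' su' FB' ->]]]]].
- by left; exists (B `&` B'); rewrite -setXI setIid; split=> //; exact: filtrationI.
- rewrite -setXI (_ : [set 0] `&` _ = set0) ?set0X//.
  by rewrite -subset0 => x [-> /=]; rewrite in_itv/= ltNge s0'.
- rewrite -setXI (_ : _ `&` [set 0] = set0) ?set0X//.
  by rewrite -subset0 => x [/[swap] -> /=]; rewrite in_itv/= ltNge s0.
- have [h|h] := ltP (Num.max s s') (Num.min u u'); last first.
    rewrite -setXI (_ : _ `&` _ = set0) ?set0X//.
    rewrite -subset0 => x [/=]; rewrite !in_itv/= => /andP[a1 a2] /andP[b1 b2].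
    have sx : Num.max s s' < x by rewrite gt_max a1 b1.
    have xu : x <= Num.min u u' by rewrite le_min a2 b2.
    by move: (lt_le_trans sx xu); rewrite ltNge h.
  right; exists (Num.max s s'), (Num.min u u'), (B `&` B'); split=> //.
  + by rewrite le_max s0.
  + apply: filtrationI; first by rewrite le_max s0.
      by apply: filtration_le FB; rewrite s0 le_max lexx.
    by apply: filtration_le FB'; rewrite s0' le_max lexx orbT.
  + rewrite -setXI; congr (_ `*` _); apply/seteqP; split=> x /=.
      move=> []; rewrite !in_itv/= => /andP[a1 a2] /andP[b1 b2].
      by rewrite gt_max a1 b1 le_min a2 b2.
    by rewrite !in_itv/= gt_max le_min => /andP[/andP[-> ->]] /andP[-> ->].
Qed.

(** Values at negative times are arbitrary, hence the restricted domain. In this form the closure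
    properties of measurable functions become available for predictable processes. *)
Lemma predictableP (H : R -> Omega -> R) : predictable F H <->
  measurable_fun ([set p | 0 <= p.1] : set predT) (fun p => H p.1 p.2).
Proof.
have E B : [set p : R * Omega | 0 <= p.1 /\ H p.1 p.2 \in B] =
    [set p | 0 <= p.1] `&` (fun p => H p.1 p.2) @^-1` B.
  by apply/seteqP; split=> p /= [p0]; rewrite inE.
split=> [pH _ B mB|mH B mB]; first by rewrite -E; exact: pH.
by rewrite E; apply: mH => //; exact: predictable_set_ge0.
Qed.

Lemma predictable_adapted (H : R -> Omega -> R) : predictable F H -> adapted F H.
Proof.
move=> pH t t0 B mB; have := predictable_set_section t0 (pH B mB).
by congr F; apply/seteqP; split=> w /= => [[]|].
Qed.

(** This is the graph of the first time at which [V] reaches level [a]. By monotonicity an earlier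
    [s] with [a <= V s] can be replaced by a rational [q] between [s] and [t], so only countably
    many sets []q, +oo[ x B] with [B] in [F q] are removed. *)
Lemma predictable_time_entry (V : R -> Omega -> R) (a : R) :
  predictable F V -> (forall w s t, 0 <= s <= t -> V s w <= V t w) ->
  predictable_set F [set p | [/\ 0 <= p.1, a <= V p.1 p.2 &
    forall s, 0 <= s < p.1 -> V s p.2 < a]].
Proof.
move=> pV ndV.
have -> : [set p | [/\ 0 <= p.1, a <= V p.1 p.2 &
    forall s, 0 <= s < p.1 -> V s p.2 < a]] =
  [set p | 0 <= p.1 /\ V p.1 p.2 \in `[a, +oo[] `\`
  \bigcup_(q : rat) (if 0 <= (ratr q : R) then
    [set p | ratr q < p.1 /\ [set w | V (ratr q) w \in `[a, +oo[] p.2] else set0).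
  apply/seteqP; split=> [[t w] /= [t0 aV Va]|[t w] /= [[t0]]].
    split; first by split=> //; rewrite in_itv/= aV.
    move=> [q _]; case: ifPn => // q0 /= [qt]; rewrite in_itv/= andbT.
    by rewrite leNgt Va// q0.
  rewrite in_itv/= andbT => aV h; split=> // s /andP[s0 st].
  rewrite ltNge; apply/negP => aVs.
  have [q] := rat_in_itvoo st; rewrite in_itv/= => /andP[sq qt].
  apply: h; exists q => //; rewrite (le_trans s0 (ltW sq))/=.
  by split=> //; rewrite in_itv/= andbT (le_trans aVs)// ndV// s0 ltW.
have mitv (B : Omega -> R) : [set w | B w \in `[a, +oo[] = [set w | B w \in `[a, +oo[%classic].
  by apply/seteqP; split=> w /=; rewrite inE.
apply: (@measurableD _ predT).
  have := pV `[a, +oo[%classic (measurable_itv _).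
  by congr predictable_set; apply/seteqP; split=> p /=; rewrite inE.
apply: bigcupT_measurable_rat => q; case: ifPn => // q0.
apply: predictable_set_after => //; rewrite mitv.
by apply: predictable_adapted => //; exact: measurable_itv.
Qed.

End filtration.

(** * Time change and the measure of an increasing process *)

Section first_hit.
Context {R : realType}.
Implicit Types f : R -> R.

(* The alternative [T <= s] caps the generalized inverse at the horizon [T], so
   that the set is never empty. *)
Definition first_hit f (T u : R) : R :=
  inf [set s | 0 <= s /\ (u <= f s \/ T <= s)].

Definition rc_nondecreasing f := (forall t, 0 <= t -> f x @[x --> t^'+] --> f t) /\
  (forall s t, 0 <= s <= t -> f s <= f t).

Lemma near_right_ex (s : R) (Q : R -> Prop) : (\forall x \near s^'+, Q x) ->
  exists2 e, 0 < e & forall x, s < x < s + e -> Q x.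
Proof.
move=> /nbhs_ballP[e /= e0 sQ]; exists e => // x /andP[sx xe].
apply: sQ => //=; rewrite /ball/= ltr_norml; lra.
Qed.

Lemma near_left_ex (s : R) (Q : R -> Prop) : (\forall x \near s^'-, Q x) ->
  exists2 e, 0 < e & forall x, s - e < x < s -> Q x.
Proof.
move=> /nbhs_ballP[e /= e0 sQ]; exists e => // x /andP[sx xe].
apply: sQ => //=; rewrite /ball/= ltr_norml; lra.
Qed.

(** Right-continuity makes the generalized inverse attain its infimum: if [f s < u] and [s < T], the
    bound [f < u] persists on an interval to the right of [s], so all members of the set stay away
    from [s]. *)
Lemma first_hit_le f T u s : rc_nondecreasing f -> 0 <= T -> 0 <= s ->
  (first_hit f T u <= s) = (u <= f s) || (T <= s).
Proof.
move=> [rcf ndf] T0 s0; pose A := [set x | 0 <= x /\ (u <= f x \/ T <= x)].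
apply/idP/idP; last first.
  by move=> /orP h; apply: ge_inf => //=; exists 0 => x [].
apply: contraTT; rewrite negb_or -!ltNge => /andP[fsu sT].
have : \forall x \near s^'+, f x < u by apply: cvgr_lt (rcf _ s0) _ fsu.
move=> /near_right_ex[e e0 fe].
apply: (@lt_le_trans _ _ (Num.min T (s + e))).
  by rewrite lt_min sT/= ltrDl.
apply: lb_le_inf; first by exists T; split=> //; right.
move=> x [x0 [ux|Tx]]; last by rewrite ge_min Tx.
rewrite ge_min; apply/orP; right; rewrite leNgt; apply/negP => xse.
have [sx|xs] := ltP s x; first by have := fe x; rewrite sx xse ltNge ux => /(_ isT).
by have := ndf x s; rewrite x0 xs => /(_ isT); lra.
Qed.

Lemma first_hit_ge0 f T u : 0 <= T -> 0 <= first_hit f T u.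
Proof.
move=> T0; apply: lb_le_inf; first by exists T; split => //; right.
by move=> x [].
Qed.

(** Times in []s, t]] correspond to levels in []f s, f t]], whose Lebesgue measure is the increment
    of [f]; this makes the time change reproduce Stieltjes integration. *)
Lemma first_hit_itv f T u s t : rc_nondecreasing f -> f 0 = 0 -> 0 <= s <= t -> t <= T ->
  (0 < u <= f T) && (s < first_hit f T u <= t) = (f s < u <= f t).
Proof.
move=> rcf f0 /andP[s0 st] tT.
have t0 : 0 <= t by lra.
have T0 : 0 <= T by lra.
rewrite [_ < first_hit _ _ _]ltNge !first_hit_le// negb_or -!ltNge.
have fs0 : 0 <= f s by rewrite -f0; apply: rcf.2; rewrite lexx.
have ftT : f t <= f T by apply: rcf.2; rewrite t0.
apply/andP/andP => [[/andP[u0 uT] /andP[/andP[fsu sT] /orP[//|]]]|[fsu uft]].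
  (* The cap matters only at the end: [T <= t] forces [t = T], and then [u <= f T] is the required
     bound. *)
  by move=> Tt; rewrite fsu; split=> //; have -> : t = T by lra.
have uT : u <= f T by lra.
have sT : s < T.
  rewrite ltNge; apply/negP => Ts.
  have : f T <= f s by apply: rcf.2; rewrite T0.
  lra.
by rewrite uT fsu uft sT/= andbT; split=> //; lra.
Qed.

End first_hit.

(** * Auxiliary facts on measurable sets and finite measures *)

Lemma measurable_set_ltr {R : realType} {d} {T : measurableType d} (f g : T -> R) :
  measurable_fun setT f -> measurable_fun setT g ->
  measurable [set x | f x < g x].
Proof.
move=> mf mg; rewrite (_ : [set x | f x < g x] = ~` [set x | g x <= f x]).
  by apply: measurableC; rewrite -[X in measurable X]setTI; exact: measurable_fun_le.
by apply/seteqP; split=> x /=; rewrite ltNge => /negP.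
Qed.

Lemma ge0_integral_mrestr {R : realType} {d} {T : measurableType d}
    (mu : {measure set T -> \bar R}) (D : set T) (mD : measurable D)
    (f : T -> \bar R) :
  measurable_fun setT f -> (forall x, 0 <= f x)%E ->
  (\int[mrestr mu mD]_x f x = \int[mu]_(x in D) f x)%E.
Proof.
move=> mf f0; rewrite -(setUv D) ge0_integral_setU//=; last 3 first.
- exact: measurableC.
- by rewrite setUv.
- by apply/disj_setPRL.
rewrite [X in (_ + X)%E](_ : _ = 0%E) ?adde0.
  by apply: eq_measure_integral => A mA AD; rewrite /= /mrestr setIidl.
rewrite (eq_measure_integral mzero) ?integral_measure_zero// => A mA AD.
have AD0 : A `&` D = set0 by rewrite -subset0 => x [/AD].
by rewrite [LHS]/= /mrestr AD0 measure0.
Qed.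

(** The sets of equal mass form a lambda-system; finiteness permits the subtraction for differences.
    Equality on [setT] is a separate assumption because [G] is not supposed to contain the whole
    space. *)
Lemma finite_measure_unique_pi {R : realType} {d} {T : measurableType d}
    (mu nu : {measure set T -> \bar R}) (G : set (set T)) :
  setI_closed G -> G `<=` measurable -> (mu setT < +oo)%E ->
  mu setT = nu setT -> (forall A, G A -> mu A = nu A) ->
  forall A, <<s G >> A -> mu A = nu A.
Proof.
move=> GI Gm muT munuT munuG A sA.
suff [] : [set A | measurable A /\ mu A = nu A] A by [].
move: A sA; apply: lambda_system_subset => //.
- split=> //.
  + move=> A B BA [mA eA] [mB eB]; split; first exact: measurableD.
    have DE (m : {measure set T -> \bar R}) :
        (m setT < +oo)%E -> m (A `\` B) = (m A - m B)%E.
      move=> mT; rewrite measureD// ?setIidr//.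
      by apply: le_lt_trans mT; apply: le_measure; rewrite ?inE.
    by rewrite (DE mu)// (DE nu) -?munuT// eA eB.
  + move=> A ndA mA; have mA' i : measurable (A i) by case: (mA i).
    have mUA : measurable (\bigcup_i A i) by exact: bigcupT_measurable.
    split=> //; have := nondecreasing_cvg_mu (mu := mu) mA' mUA ndA.
    have -> : mu \o A = nu \o A by apply/funext => n /=; case: (mA n).
    move=> cmu; exact: (cvg_unique _ cmu (nondecreasing_cvg_mu mA' mUA ndA)).
- by move=> A GA; split; [exact: Gm|exact: munuG].
Qed.

(** * The Doléans measure of an increasing process, via the time change *)

Section time_change.
Context {R : realType} {d : measure_display} {Omega : measurableType d}.
Context (P : probability Omega R).
Implicit Types (U V : R -> Omega -> R).

Record integrable_increasing U : Prop := IntegrableIncreasing {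
  incr_path : forall w, rc_nondecreasing (U ^~ w);
  incr0 : forall w, U 0 w = 0;
  incr_integrable : forall t, 0 <= t -> P.-integrable setT (EFin \o U t)
}.

Section fixU.
Context U (T : R).
Hypotheses (HU : integrable_increasing U) (T0 : 0 <= T).

Lemma incr_measurable t : 0 <= t -> measurable_fun setT (U t).
Proof.
by move=> /(incr_integrable HU) /measurable_int /measurable_EFinP.
Qed.

Lemma incr_ge0 t w : 0 <= t -> 0 <= U t w.
Proof.
move=> t0; rewrite -(incr0 HU w); apply: (incr_path HU w).2.
by rewrite lexx.
Qed.

Lemma incr_le s t w : 0 <= s <= t -> U s w <= U t w.
Proof. exact: (incr_path HU w).2. Qed.

Definition time_change (p : Omega * measurableTypeR R) : R * Omega :=
  (first_hit (U ^~ p.1) T p.2, p.1).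

(** Rays []x, +oo[] generate, and by [first_hit_le] the preimage of such a ray with [0 <= x] is
    [U x w < u] when [x < T] and empty otherwise: a comparison of two measurable functions. *)
Lemma measurable_time_change : measurable_fun setT time_change.
Proof.
apply/measurable_fun_pairP; split; last exact: measurable_fst.
apply: (measurability _ (RGenOInfty.measurableE R)) => //.
move=> _ [_ [x ->] <-]; rewrite setTI.
have [x0|x0] := ltP x 0.
  rewrite (_ : _ @^-1` _ = setT)//; apply/seteqP; split=> // p _ /=.
  by rewrite in_itv/= andbT (lt_le_trans x0)// first_hit_ge0.
rewrite (_ : _ @^-1` _ = if x < T then [set p : Omega * measurableTypeR R | U x p.1 < p.2] else set0).
  case: ifPn => // _.
  apply: measurable_set_ltr => //.
  by apply: (measurableT_comp (incr_measurable x0)); exact: measurable_fst.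
have E p : (x < first_hit (U ^~ p.1) T p.2) = (U x p.1 < p.2) && (x < T).
  rewrite ltNge first_hit_le ?negb_or -?ltNge//; exact: (incr_path HU).
apply/seteqP; split=> p /=; rewrite in_itv/= andbT E.
  by case: ifPn => xT /=; rewrite ?andbT// ?andbF.
by case: ifPn => xT /=; rewrite ?andbT// ?andbF.
Qed.

Definition time_change_dom : set (Omega * measurableTypeR R) := [set p | 0 < p.2 <= U T p.1].

Lemma measurable_time_change_dom : measurable time_change_dom.
Proof.
rewrite (_ : time_change_dom = [set p | 0 < p.2] `&` [set p | p.2 <= U T p.1]).
  apply: measurableI.
    exact: measurable_set_ltr.
  rewrite -[X in measurable X]setTI.
  apply: measurable_fun_le => //.
  by apply: (measurableT_comp (incr_measurable T0)); exact: measurable_fst.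
by apply/seteqP; split=> p /= => [/andP[]|[? ?]]//; exact/andP.
Qed.

Let leb : {sigma_finite_measure set (measurableTypeR R) -> \bar R} := @lebesgue_measure R.

Let PxLeb : {measure set (Omega * measurableTypeR R) -> \bar R} := (P \x leb)%E.

(* Pushing Lebesgue measure forward, rather than integrating the Stieltjes
   measures of the paths, makes joint measurability in (t, w) immediate. *)
Definition time_change_measure : {measure set (Omega * measurableTypeR R) -> \bar R} :=
  mrestr PxLeb measurable_time_change_dom.

(** The Doléans measure [S |-> E[int_0^T 1_S dU]], realized as an image of Lebesgue measure on the
    levels. *)
Definition doleans_measure : {measure set (R * Omega) -> \bar R}.
Proof.
unshelve refine (pushforward time_change_measure time_change
  : {measure set _ -> \bar R}).
exact: measurable_time_change.
Defined.

Lemma ge0_integral_doleans (H : R * Omega -> \bar R) :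
  measurable_fun setT H -> (forall p, 0 <= H p)%E ->
  (\int[doleans_measure]_p H p =
   \int[P]_w \int[lebesgue_measure]_(u in `]0%R, U T w])
     H (time_change (w, u)))%E.
Proof.
move=> mH H0.
have mHt : measurable_fun setT (H \o time_change).
  exact: (measurableT_comp mH measurable_time_change).
apply: etrans.
  exact: (@ge0_integral_pushforward _ _ _ _ _ _ measurable_time_change
    time_change_measure setT H measurableT mH (fun y _ => H0 y)).
rewrite preimage_setT ge0_integral_mrestr//; last by move=> p; exact: H0.
rewrite integral_mkcond fubini_tonelli1; last 2 first.
- apply/(measurable_restrictT _ measurable_time_change_dom).
  exact: measurable_funTS.
- by move=> p; apply: erestrict_ge0 => x _; exact: H0.
apply: eq_integral => w _; rewrite /fubini_F [RHS]integral_mkcond.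
apply: eq_integral => u _; rewrite /patch !mem_setE /=.
by rewrite in_itv/=.
Qed.

(** At fixed [w] the levels concerned form an interval of length [U t w - U s w]. The weight [k] may
    look beyond time [s], as it does in the right-endpoint sums of the uniqueness proof. *)
Lemma integral_doleans_step (s t : R) (k : Omega -> R) : 0 <= s <= t -> t <= T ->
  measurable_fun setT k -> (forall w, 0 <= k w) ->
  (\int[doleans_measure]_p (k p.2 * \1_(`]s, t] : set R) p.1)%:E =
   \int[P]_w (k w * (U t w - U s w))%:E)%E.
Proof.
move=> st tT mk k0; rewrite ge0_integral_doleans//; last 2 first.
- apply/measurable_EFinP; apply: measurable_funM.
    by apply: (measurableT_comp mk); exact: measurable_snd.
  by apply: (measurableT_comp (measurable_indic _)).
- by move=> p; rewrite lee_fin mulr_ge0.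
apply: eq_integral => w _ /=.
have mU : U s w <= U t w by exact: incr_le.
rewrite integral_mkcond/=.
transitivity (\int[lebesgue_measure]_u ((k w)%:E *
    (\1_(`]U s w, U t w] : set R) u)%:E))%E.
  apply: eq_integral => u _; rewrite patchE /= -EFinM mem_setE/= !indicE !mem_setE.
  have := first_hit_itv u (incr_path HU w) (incr0 HU w) st tT.
  rewrite !in_itv/=; case: (0 < u <= U T w) => /= <- //.
  by rewrite mulr0.
rewrite ge0_integralZl//; last 2 first.
- by apply/measurable_EFinP; exact: measurable_indic.
- by rewrite lee_fin.
rewrite integral_indic// setIT /= lebesgue_measure_itv/= lte_fin EFinM.
move: mU; rewrite le_eqVlt => /orP[/eqP <-|h]; first by rewrite ltxx subrr.
by rewrite h EFinB.
Qed.

Lemma doleans_rectangle (s t : R) (B : set Omega) : 0 <= s <= t -> t <= T ->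
  measurable B ->
  (doleans_measure (`]s, t] `*` B) = \int[P]_(w in B) (U t w - U s w)%:E)%E.
Proof.
move=> st tT mB.
rewrite -[LHS]mul1e -integral_cst; last exact: measurableX.
rewrite integral_mkcond [RHS]integral_mkcond.
transitivity (\int[doleans_measure]_p
    (\1_B p.2 * \1_(`]s, t] : set R) p.1)%:E)%E.
  apply: eq_integral => -[x w] _; rewrite patchE /= !indicE in_setX/=.
  by case: (x \in _); case: (w \in B); rewrite /= ?mul1r ?mul0r.
rewrite integral_doleans_step//.
apply: eq_integral => w _; rewrite patchE/= indicE.
by case: ifPn => _ /=; rewrite ?mul1r ?mul0r.
Qed.

Lemma doleans_setT : (doleans_measure setT = \int[P]_w (U T w)%:E)%E.
Proof.
rewrite -[LHS]mul1e -integral_cst// ge0_integral_doleans//.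
apply: eq_integral => w _.
rewrite integral_cst//= mul1e lebesgue_measure_itv/= lte_fin.
have := incr_ge0 w T0; rewrite le_eqVlt => /orP[/eqP <-|->]; first by rewrite ltxx.
by rewrite sube0.
Qed.

Lemma doleans_fin : (doleans_measure setT < +oo)%E.
Proof.
rewrite doleans_setT; have /integrableP[_] := incr_integrable HU T0.
congr (_ < _)%E; apply: eq_integral => w _ /=.
by rewrite ger0_norm// incr_ge0.
Qed.

(** The measure is concentrated on []0, T] x Omega], since the time change sends the levels in []0,
    U T w]] into []0, T]]. *)
Lemma doleans_congr (S S' : set (R * Omega)) :
  (forall p, 0 < p.1 <= T -> S p <-> S' p) ->
  doleans_measure S = doleans_measure S'.
Proof.
move=> SS'; rewrite /doleans_measure/= /pushforward/= /mrestr; congr (PxLeb _).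
have h p : time_change_dom p -> 0 < (time_change p).1 <= T.
  move=> pD; have T0T : (0 : R) <= 0 <= T by rewrite lexx.
  have := first_hit_itv p.2 (incr_path HU p.1) (incr0 HU p.1) T0T (lexx T).
  by rewrite (incr0 HU); move: pD; rewrite /time_change_dom/= => -> /=.
by apply/seteqP; split=> p [? pD]; split=> //; apply/(SS' (time_change p)) => //; exact: h.
Qed.

(** The levels concerned lie over a measurable null cover of [N], and a null set times the real line
    has product measure zero. *)
Lemma doleans_null (S : set (R * Omega)) (N : set Omega) :
  measurable S -> P.-negligible N ->
  (forall p, time_change_dom p -> S (time_change p) -> N p.1) ->
  doleans_measure S = 0%E.
Proof.
move=> mS [N' [mN' PN' NN']] SN.
apply/eqP; rewrite eq_le measure_ge0 andbT.
have mA : measurable (time_change @^-1` S `&` time_change_dom).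
  apply: measurableI; last exact: measurable_time_change_dom.
  by rewrite -[X in measurable X]setTI; exact: measurable_time_change.
pose B : set (Omega * measurableTypeR R) := N' `*` setT.
have mB : measurable B by exact: measurableX.
have PxLebB : PxLeb B = 0%E.
  by rewrite /PxLeb /= product_measure1E//= PN' mul0e.
have AB : time_change @^-1` S `&` time_change_dom `<=` B.
  by move=> p [Sp Dp]; split=> //; apply: NN'; exact: SN.
rewrite -PxLebB; exact: (le_measure PxLeb (mem_set mA) (mem_set mB) AB).
Qed.

(** For almost every [w] the section of the pulled-back set is Lebesgue null, so it contains no
    interval of levels. A jump of a path would produce such an interval. *)
Lemma doleans_eq0_ae (S : set (R * Omega)) : measurable S ->
  doleans_measure S = 0%E ->
  {ae P, forall w, forall x y, x < y ->
    ~ (forall u, x < u <= y -> time_change_dom (w, u) /\ S (time_change (w, u)))}.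
Proof.
move=> mS; pose A := time_change @^-1` S `&` time_change_dom.
have mA : measurable A.
  apply: measurableI; last exact: measurable_time_change_dom.
  by rewrite -[X in measurable X]setTI; exact: measurable_time_change.
rewrite (_ : doleans_measure S = (\int[P]_w leb (xsection A w))%E)//.
move=> IA0; have : ae_eq P setT (leb \o xsection A) (cst 0%E).
  apply/(ae_eq_integral_abs P measurableT); first exact: measurable_fun_xsection.
  rewrite -[RHS]IA0; apply: eq_integral => w _.
  by rewrite gee0_abs//= measure_ge0.
apply: filterS => w /(_ Logic.I) A0' x y xy Sxy.
have A0 : leb (xsection A w) = 0%E := A0'.
have mxy : measurable (`]x, y]%classic : set (measurableTypeR R)) by exact: measurable_itv.
have : (leb `]x, y]%classic <= leb (xsection A w))%E.
  apply: le_measure; rewrite ?inE//; first exact: measurable_xsection.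
  move=> u /=; rewrite in_itv/= => /Sxy[Dwu Swu].
  by rewrite /xsection/= inE.
rewrite A0 /leb /= lebesgue_measure_itv/= lte_fin xy -EFinB lee_fin.
by rewrite leNgt subr_gt0 xy.
Qed.

End fixU.

(** * Agreement of Doléans measures on predictable sets *)

Section dual_predictable_projection.
Context (F : R -> set (set Omega)).
Hypothesis HF : usual_filtration P F.

(** For integrable adapted processes this says that [U - V] is a martingale. The form with
    increments is the one tested by the rectangles []s, t] x B]. *)
Definition same_increments U V := forall s t B, 0 <= s <= t -> F s B ->
  (\int[P]_(w in B) (U t w - U s w)%:E = \int[P]_(w in B) (V t w - V s w)%:E)%E.

Section fixUV.
Context U V (T : R).
Hypotheses (HU : integrable_increasing U) (HV : integrable_increasing V).
Hypotheses (T0 : 0 <= T) (UV : same_increments U V).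

Let muU := doleans_measure HU T0.
Let muV := doleans_measure HV T0.

(** For [t <= T] the equality on []s, t] x B] is [same_increments]. Rectangles at time 0 or beyond
    [T] are null, and an interval crossing [T] is cut at [T]. *)
Lemma doleans_predictable_set C : predictable_set F C -> muU C = muV C.
Proof.
move=> FC; apply: (finite_measure_unique_pi (setI_closed_predictable_rectangles HF)) C FC.
- move=> A GA; apply: (predictable_set_measurable HF).
  exact: sub_sigma_algebra.
- exact: doleans_fin.
- rewrite !doleans_setT.
  have h0T : (0 : R) <= 0 <= T by rewrite lexx.
  have := UV h0T (filtrationT HF (lexx 0)).
  under eq_integral do rewrite (incr0 HU) subr0.
  by under [RHS]eq_integral do rewrite (incr0 HV) subr0.
- move=> C FC.
  case: FC => [[B [FB ->]]|[s [t [B [s0 st FB ->]]]]].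
    have E (W : R -> Omega -> R) (HW : integrable_increasing W) :
        doleans_measure HW T0 ([set 0] `*` B) = 0%E.
      rewrite (@doleans_congr _ _ _ _ _ set0) ?measure0// => p /andP[p0 _].
      by split=> // -[/= p00]; rewrite p00 ltxx in p0.
    by rewrite /muU /muV !E.
  have [Ts|sT] := leP T s.
    have E (W : R -> Omega -> R) (HW : integrable_increasing W) :
        doleans_measure HW T0 (`]s, t] `*` B) = 0%E.
      rewrite (@doleans_congr _ _ _ _ _ set0) ?measure0// => p /andP[_ pT].
      split=> // -[/=]; rewrite in_itv/= => /andP[sp _].
      by move: (le_lt_trans (le_trans pT Ts) sp); rewrite ltxx.
    by rewrite /muU /muV !E.
  have E (W : R -> Omega -> R) (HW : integrable_increasing W) :
      doleans_measure HW T0 (`]s, t] `*` B) =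
      doleans_measure HW T0 (`]s, Num.min t T] `*` B).
    apply: doleans_congr => p /andP[_ pT].
    by rewrite /setX/= !in_itv/= le_min pT andbT.
  have stT : s <= Num.min t T by rewrite le_min !ltW.
  have mB : measurable B by apply: (filtration_measurable HF) FB.
  rewrite /muU /muV !E !doleans_rectangle ?ge_min ?lexx ?orbT ?s0 ?stT//.
  by apply: UV => //; rewrite s0.
Qed.

Lemma doleans_predictable_integral
    (H : g_sigma_algebraType (predictable_rectangles F) -> \bar R) :
  measurable_fun setT H -> (forall p, 0 <= H p)%E ->
  (\int[muU]_p H p = \int[muV]_p H p)%E.
Proof.
move=> mH H0.
(* The identity between two sigma-algebras: pushing forward along it restricts a measure to the
   predictable sets, where [muU] and [muV] coincide. *)
pose i : R * Omega -> g_sigma_algebraType (predictable_rectangles F) := id.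
have mi : measurable_fun setT i.
  by move=> _ B mB; rewrite setTI; exact: (predictable_set_measurable HF).
have E (mu : {measure set (R * Omega) -> \bar R}) :
    (\int[mu]_p H p = \int[pushforward mu i]_p H p)%E.
  by rewrite (@ge0_integral_pushforward _ _ _ _ _ _ mi mu setT H).
rewrite !E; apply: eq_measure_integral => A mA _.
exact: doleans_predictable_set.
Qed.

End fixUV.
End dual_predictable_projection.
End time_change.

(** * Uniqueness of compensators *)

Section convex_test_function.
Context {R : realType}.
Implicit Types x y : R.

(** Convex, vanishing only at 0, and of bounded derivative, so that the first moments of the
    processes control [phi (M T)] and the slopes. *)
Definition phi x := Num.sqrt (1 + x ^+ 2) - 1.
(* [slope] is the derivative of [x + phi x]; the linear term makes it
   nonnegative, so that only integrals of nonnegative functions occur. *)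
Definition slope x := 1 + x / Num.sqrt (1 + x ^+ 2).

Lemma sqrt1D_gt0 x : 0 < Num.sqrt (1 + x ^+ 2).
Proof. by rewrite sqrtr_gt0 ltr_pwDl// sqr_ge0. Qed.

Lemma sqr_sqrt1D x : Num.sqrt (1 + x ^+ 2) ^+ 2 = 1 + x ^+ 2.
Proof. by rewrite sqr_sqrtr// addr_ge0// sqr_ge0. Qed.

Lemma phi_ge0 x : 0 <= phi x.
Proof. by have := sqrt1D_gt0 x; have := sqr_sqrt1D x; rewrite /phi; nra. Qed.

Lemma phi_eq0 x : phi x = 0 -> x = 0.
Proof.
have := sqr_sqrt1D x; rewrite /phi => + /eqP; rewrite subr_eq0 => /[swap] /eqP ->.
move=> h; have /eqP : x ^+ 2 = 0 by lra.
by rewrite sqrf_eq0 => /eqP.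
Qed.

Lemma phi0 : phi 0 = 0.
Proof. by rewrite /phi expr0n/= addr0 sqrtr1 subrr. Qed.

(** Tangent inequality at [y] for the convex function [x + phi x]; the tangent is taken at the later
    value because the integrand is [phi'(M_s)] and not its left limit. It reduces to the
    Cauchy-Schwarz inequality [1 + x * y <= a * b] for the vectors [(1, x)] and [(1, y)]. *)
Lemma phi_convex x y : y - x + (phi y - phi x) <= slope y * (y - x).
Proof.
rewrite /phi /slope; move: (sqrt1D_gt0 x) (sqr_sqrt1D x) (sqrt1D_gt0 y) (sqr_sqrt1D y).
set a := Num.sqrt _; set b := Num.sqrt _ => a0 a2 b0 b2.
suff : b - a <= y / b * (y - x) by lra.
rewrite mulrAC ler_pdivlMr//.
suff : 1 + x * y <= a * b by nra.
rewrite leNgt; apply/negP => h.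
have : (a * b) ^+ 2 < (1 + x * y) ^+ 2.
  by rewrite ltrXn2r// ?mulr_ge0// ?ltW// (lt_trans _ h)// mulr_gt0.
by rewrite exprMn a2 b2; have := sqr_ge0 (x - y); lra.
Qed.

Lemma slope_bound x : 0 <= slope x <= 2.
Proof.
have a0 := sqrt1D_gt0 x; have a2 := sqr_sqrt1D x; rewrite /slope.
move: a0 a2; set a := Num.sqrt _ => a0 a2.
have xa : x <= a by rewrite leNgt; apply/negP => h; nra.
have ax : - a <= x by rewrite leNgt; apply/negP => h; nra.
have : - 1 <= x / a by rewrite ler_pdivlMr// mulN1r.
have : x / a <= 1 by rewrite ler_pdivrMr// mul1r.
lra.
Qed.

Lemma slope_continuous : continuous (slope : R -> R).
Proof.
move=> x; apply: cvgD; first exact: cvg_cst.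
apply: cvgM; first exact: cvg_id.
apply: cvgV; first by rewrite gt_eqF// sqrt1D_gt0.
apply: (continuous_comp (f := fun x : R => 1 + x ^+ 2)); last exact: sqrt_continuous.
by apply: cvgD; [exact: cvg_cst|exact: exprn_continuous].
Qed.

Lemma phi_continuous : continuous (phi : R -> R).
Proof.
move=> x; apply: cvgB; last exact: cvg_cst.
apply: (continuous_comp (f := fun x : R => 1 + x ^+ 2)); last exact: sqrt_continuous.
by apply: cvgD; [exact: cvg_cst|exact: exprn_continuous].
Qed.

End convex_test_function.

(** A right-endpoint step function on a grid of mesh [h]: a single cell contains [x], and its right
    end lies within [h] of [x]. Vanishing beyond the grid is carried along for the induction. *)
Lemma grid_sum {R : realType} (h : R) (c : R -> R) (x : R) (m : nat) :
  0 < h -> 0 < x ->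
  let s := \sum_(i < m) c (i.+1%:R * h) *
    \1_(`](i%:R * h), (i.+1%:R * h)] : set R) x in
  (x <= m%:R * h -> exists2 r, x <= r < x + h & s = c r) /\
  (m%:R * h < x -> s = 0).
Proof.
move=> h0 x0; elim: m => [|m [IH1 IH2]] /=.
  by split; [rewrite mul0r leNgt x0|rewrite big_ord0].
rewrite big_ord_recr/= indicE mem_setE in_itv/=.
have mh : m.+1%:R * h = m%:R * h + h by rewrite -natr1 mulrDl mul1r.
split=> [xm|xm]; last first.
  rewrite IH2 ?add0r; last by lra.
  by rewrite [X in _ && X]leNgt xm andbF mulr0.
have [mx|xm'] := ltP (m%:R * h) x.
  rewrite IH2// xm add0r mulr1; exists (m.+1%:R * h) => //.
  by rewrite xm/= mh; lra.
have [r rx ->] := IH1 xm'; exists r => //.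
by rewrite mulr0 addr0.
Qed.

Lemma ae_forall_count {R : realType} {d} {T : measurableType d}
    (mu : {measure set T -> \bar R}) (I : countType) (Q : I -> T -> Prop) :
  (forall i, {ae mu, forall x, Q i x}) -> {ae mu, forall x, forall i, Q i x}.
Proof.
move=> aeQ.
have : {ae mu, forall x, forall n, if @unpickle I n is Some i then Q i x else True}.
  apply: ae_foralln => n; case: unpickle => [i|]; first exact: aeQ.
  exact/nearW.
by apply: filterS => x Qx i; have := Qx (pickle i); rewrite pickleK.
Qed.

Lemma integral_bounded_fin_num {R : realType} {d} {T : measurableType d}
    (mu : {measure set T -> \bar R}) (f : T -> R) (c : R) :
  (mu setT < +oo)%E -> measurable_fun setT f -> (forall x, 0 <= f x <= c) ->
  (\int[mu]_x (f x)%:E)%E \is a fin_num.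
Proof.
move=> muT mf fc; rewrite ge0_fin_numE; last first.
  by apply: integral_ge0 => p _; rewrite lee_fin; case/andP: (fc p).
apply: (@le_lt_trans _ _ (\int[mu]_x c%:E)%E).
  apply: ge0_le_integral => //.
  - by move=> p _; rewrite lee_fin; case/andP: (fc p).
  - exact/measurable_EFinP.
  - by move=> p _; rewrite lee_fin; case/andP: (fc p).
have [x|T0] := pselect (exists x : T, True); last first.
  by rewrite (_ : setT = set0) ?integral_set0// -subset0 => x _; apply: T0; exists x.
have c0 : 0 <= c by case: x => x _; have /andP[] := fc x; exact: le_trans.
by rewrite integral_cst//= lte_mul_pinfty.
Qed.

Lemma integral_eq0_ae {R : realType} {d} {T : measurableType d}
    (mu : {measure set T -> \bar R}) (f : T -> R) :
  measurable_fun setT f -> (forall x, 0 <= f x) ->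
  (\int[mu]_x (f x)%:E)%E = 0%E -> {ae mu, forall x, f x = 0}.
Proof.
move=> mf f0 If0.
have : ae_eq mu setT (EFin \o f) (cst 0%E).
  apply/(ae_eq_integral_abs mu measurableT); first exact/measurable_EFinP.
  by rewrite -If0; apply: eq_integral => x _; rewrite /= ger0_norm.
by apply: filterS => x /(_ Logic.I) [].
Qed.

(** The common limit is finite, so [a n - b n] tends to 0 while staying above [c]. *)
Lemma cvge_shift_le {R : realType} (a b : (\bar R)^nat) (c l : \bar R) :
  a @ \oo --> l -> b @ \oo --> l -> l \is a fin_num ->
  (forall n, b n \is a fin_num) -> (forall n, c + b n <= a n)%E -> (c <= 0)%E.
Proof.
move=> al bl lfin bfin cab.
have abl : (fun n => a n - b n)%E @ \oo --> 0%E.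
  rewrite -(subee lfin); apply: cvgeB => //.
  by apply: fin_num_adde_defl; rewrite fin_numN.
rewrite -(cvg_lim _ abl)//; apply: lime_ge; first by apply/cvg_ex; exists 0%E.
by apply: nearW => n; rewrite leeBrDr.
Qed.

(** * Predictable increasing processes with the same increments are indistinguishable *)

Section uniqueness.
Context {R : realType} {d : measure_display} {Omega : measurableType d}.
Context {P : probability Omega R} {F : R -> set (set Omega)}.
Hypothesis HF : usual_filtration P F.
Context {U V : R -> Omega -> R}.
Hypotheses (HU : integrable_increasing P U) (HV : integrable_increasing P V).
Hypotheses (pU : predictable F U) (pV : predictable F V).
Hypothesis UV : same_increments P F U V.

Let M t w := U t w - V t w.

Let measurable_M t : 0 <= t -> measurable_fun setT (M t).
Proof.
by move=> t0; apply: measurable_funB; [exact: (incr_measurable HU)|exact: (incr_measurable HV)].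
Qed.

Let measurable_slopeM t : 0 <= t -> measurable_fun setT (fun w => slope (M t w)).
Proof.
move=> t0; apply: measurableT_comp (measurable_M t0).
by apply: continuous_measurable_fun; exact: slope_continuous.
Qed.

Section horizon.
Variable T : R.
Hypothesis T0 : 0 < T.
Let T0' : 0 <= T := ltW T0.

Let muU := doleans_measure HU T0'.
Let muV := doleans_measure HV T0'.

Let h n : R := T / n.+1%:R.
Let h_gt0 n : 0 < h n. Proof. by rewrite divr_gt0. Qed.
Let hT n : n.+1%:R * h n = T. Proof. by rewrite mulrC divfK. Qed.

(** Right-endpoint discretization of [H]. It looks ahead to the end of each cell, so it is only
    jointly measurable; predictability enters through the limit [H] alone. *)
Let Hn n (p : R * Omega) : R := \sum_(i < n.+1) slope (M (i.+1%:R * h n) p.2) *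
  \1_(`](i%:R * h n), (i.+1%:R * h n)] : set R) p.1.

Let H (p : R * Omega) : R :=
  slope (M p.1 p.2) * \1_(`]0, T] : set R) p.1.

Let HnP n x w : 0 < x -> x <= T ->
  exists2 r, x <= r < x + h n & Hn n (x, w) = slope (M r w).
Proof.
move=> x0 xT.
have [+ _] := grid_sum (fun r => slope (M r w)) n.+1 (h_gt0 n) x0.
by rewrite hT => /(_ xT).
Qed.

Let indic_slope_bound (c : R) (A : set R) (x : R) : 0 <= slope c * \1_A x <= 2.
Proof.
have := slope_bound c; rewrite indicE; case: (x \in A); rewrite ?mulr1 ?mulr0//.
by move=> _; rewrite lexx ler0n.
Qed.

Let Hn_out n x w : ~ (0 < x <= T) -> Hn n (x, w) = 0.
Proof.
move=> xT; rewrite /Hn big1// => i _; rewrite indicE mem_setE in_itv/=.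
case: (boolP (_ && _)) => [/andP[ix xi]|_]; last by rewrite mulr0.
exfalso; apply: xT.
apply/andP; split.
  by apply: le_lt_trans ix; rewrite mulr_ge0// ltW.
by apply: (le_trans xi); rewrite -(hT n) ler_pM2r// ler_nat.
Qed.

Let Hn_bound n p : 0 <= Hn n p <= 2.
Proof.
case: p => x w; have [/andP[x0 xT]|/negP xT] := boolP (0 < x <= T).
  by have [r _ ->] := HnP n w x0 xT; exact: slope_bound.
by rewrite Hn_out// lexx ler0n.
Qed.

Let H_bound p : 0 <= H p <= 2. Proof. exact: indic_slope_bound. Qed.

(** The sampling point lies in [[x, x + h n[], so right-continuity of [M] suffices. It may equal
    [x], which the punctured right neighbourhood leaves out; hence the separate case. *)
Let cvg_Hn p : (fun n => Hn n p) @ \oo --> H p.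
Proof.
case: p => x w; have [/andP[x0 xT]|/negP xT] := boolP (0 < x <= T); last first.
  rewrite (_ : (fun n => _) = cst 0); last by apply/funext => n; exact: Hn_out.
  rewrite /H /= indicE mem_setE in_itv/= (negbTE (introN idP xT)) mulr0.
  exact: cvg_cst.
rewrite /H /= indicE mem_setE in_itv/= x0 xT mulr1.
apply/cvgrPdist_lt => e e0.
have : (fun y => slope (M y w)) y @[y --> x^'+] --> slope (M x w).
  apply: continuous_cvg; first exact: slope_continuous.
  by apply: cvgB; [apply: (incr_path HU w).1|apply: (incr_path HV w).1]; exact: ltW.
move=> /cvgrPdist_lt/(_ e e0)/near_right_ex[r r0 xr].
have : \forall n \near \oo, h n < r.
  have : (fun n => T * (n.+1%:R)^-1 : R) @ \oo --> T * 0.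
    by apply: cvgM; [exact: cvg_cst|exact: cvg_harmonic].
  by rewrite mulr0 => /cvgr_lt/(_ _ r0).
apply: filterS => n hr; have [y /andP[xy yx] ->] := HnP n w x0 xT.
have [<-|xNy] := eqVneq x y; first by rewrite subrr normr0.
by apply: xr; rewrite lt_neqAle xNy xy/=; lra.
Qed.

Let measurable_Hn n : measurable_fun setT (Hn n).
Proof.
apply: measurable_sum => i; apply: measurable_funM.
  apply: (measurableT_comp (@measurable_slopeM _ _)); last exact: measurable_snd.
  by rewrite mulr_ge0// ltW.
by apply: (measurableT_comp (measurable_indic _)) => //; exact: measurable_fst.
Qed.

Let measurable_H :
  measurable_fun (setT : set (g_sigma_algebraType (predictable_rectangles F))) H.
Proof.
have mD : measurable ([set p | 0 <= p.1] :
    set (g_sigma_algebraType (predictable_rectangles F))).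
  exact: (predictable_set_ge0 HF).
(* Predictability controls [M] only at nonnegative times; the indicator of []0, T]] allows [M] to be
   replaced by 0 elsewhere. *)
have -> : H = (fun p => slope (((fun p => M p.1 p.2) \_ [set p | 0 <= p.1]) p) *
    (\1_(`]0, T] : set R) p.1)).
  apply/funext => p; rewrite /H indicE mem_setE in_itv/= patchE.
  case: (boolP (0 < p.1 <= T)) => [/andP[p0 _]|]; last by rewrite !mulr0.
  by rewrite ifT// inE/= ltW.
apply: measurable_funM.
  apply: (measurableT_comp (continuous_measurable_fun (@slope_continuous R))).
  apply/(measurable_restrictT _ mD).
  by apply: measurable_funB; apply/(predictableP HF).
apply: measurable_indic; apply: sub_sigma_algebra; right; exists 0, T, setT.
split=> //; first exact: (filtrationT HF).
by apply/seteqP; split=> p //= [].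
Qed.

Let integral_Hn (W : R -> Omega -> R) (HW : integrable_increasing P W) n :
  (\int[doleans_measure HW T0']_p (Hn n p)%:E =
   \int[P]_w (\sum_(i < n.+1) slope (M (i.+1%:R * h n) w) *
     (W (i.+1%:R * h n) w - W (i%:R * h n) w))%:E)%E.
Proof.
under eq_integral do rewrite /Hn -sumEFin.
under [RHS]eq_integral do rewrite -sumEFin.
have hi i : 0 <= i%:R * h n by rewrite mulr_ge0// ltW.
have hii (i : nat) : i%:R * h n <= i.+1%:R * h n by rewrite ler_pM2r// ler_nat.
rewrite !ge0_integral_sum//.
- apply: eq_bigr => i _; rewrite (integral_doleans_step HW T0'
    (k := fun w => slope (M (i.+1%:R * h n) w))) ?hi ?hii//.
  + by rewrite -(hT n) ler_pM2r// ler_nat.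
  + exact: measurable_slopeM.
  + by move=> w; have /andP[] := slope_bound (M (i.+1%:R * h n) w).
- move=> i; apply/measurable_EFinP; apply: measurable_funM.
    exact: measurable_slopeM.
  by apply: measurable_funB; exact: (incr_measurable HW).
- move=> i w _; rewrite lee_fin mulr_ge0//.
    by have /andP[] := slope_bound (M (i.+1%:R * h n) w).
  by rewrite subr_ge0 (incr_le HW)// hi hii.
- move=> i; apply/measurable_EFinP; apply: measurable_funM.
    apply: (measurableT_comp (measurable_slopeM (hi _))); exact: measurable_snd.
  by apply: (measurableT_comp (measurable_indic _)) => //; exact: measurable_fst.
- move=> i p _; rewrite lee_fin.
  by have /andP[] := indic_slope_bound (M (i.+1%:R * h n) p.2) `](i%:R * h n), (i.+1%:R * h n)] p.1.
Qed.

Let cvg_integral_Hn (W : R -> Omega -> R) (HW : integrable_increasing P W) :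
  (\int[doleans_measure HW T0']_p (Hn n p)%:E)%E @[n --> \oo] -->
  (\int[doleans_measure HW T0']_p (H p)%:E)%E.
Proof.
apply: (@dominated_cvg _ _ _ _ _ _ _ _ (cst 2%:E)) => //.
- by move=> n; apply/measurable_EFinP.
- by move=> p _; apply: cvg_EFin; [exact: nearW|exact: cvg_Hn].
- apply/integrableP; split=> //.
  rewrite (eq_integral (cst 2%:E)); last by move=> p _; rewrite /= ger0_norm.
  rewrite integral_cst//= lte_mul_pinfty//.
  by exact: doleans_fin.
- by move=> n p _; have /andP[H0 H2] := Hn_bound n p; rewrite /= lee_fin ger0_norm.
Qed.

(** The tangent inequality summed over the cells telescopes. The terms in [U] and [V] are
    distributed so that both sides consist of nonnegative terms, ready for integration in the
    extended reals. *)
Let sum_slope_increments n w :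
  phi (M T w) + U T w + \sum_(i < n.+1) slope (M (i.+1%:R * h n) w) *
     (V (i.+1%:R * h n) w - V (i%:R * h n) w) <=
  V T w + \sum_(i < n.+1) slope (M (i.+1%:R * h n) w) *
     (U (i.+1%:R * h n) w - U (i%:R * h n) w).
Proof.
suff : M T w + phi (M T w) <= \sum_(i < n.+1) slope (M (i.+1%:R * h n) w) *
     (M (i.+1%:R * h n) w - M (i%:R * h n) w).
  have -> : \sum_(i < n.+1) slope (M (i.+1%:R * h n) w) *
     (M (i.+1%:R * h n) w - M (i%:R * h n) w) =
     \sum_(i < n.+1) slope (M (i.+1%:R * h n) w) *
     (U (i.+1%:R * h n) w - U (i%:R * h n) w) -
     \sum_(i < n.+1) slope (M (i.+1%:R * h n) w) *
     (V (i.+1%:R * h n) w - V (i%:R * h n) w).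
    rewrite -sumrB; apply: eq_bigr => i _; rewrite -mulrBr /M; congr (_ * _).
    by ring.
  by rewrite /M; lra.
have M0 : M 0 w = 0 by rewrite /M (incr0 HU) (incr0 HV) subrr.
have telescope m : M (m%:R * h n) w + phi (M (m%:R * h n) w) <=
    \sum_(i < m) slope (M (i.+1%:R * h n) w) *
     (M (i.+1%:R * h n) w - M (i%:R * h n) w).
  elim: m => [|m IH]; first by rewrite mul0r M0 phi0 addr0 big_ord0.
  rewrite big_ord_recr/=.
  have := phi_convex (M (m%:R * h n) w) (M (m.+1%:R * h n) w); lra.
by rewrite -{1 2}(hT n).
Qed.

(** With [c] the mean of [phi (M T)], the discrete inequality gives
    [c + int Hn dmuV <= int Hn dmuU]. Both integrals tend to that of the predictable [H], on which
    the two measures agree, so [c = 0]. *)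
Lemma increasing_eq_at : {ae P, forall w, U T w = V T w}.
Proof.
have hi n (i : nat) : 0 <= i%:R * h n by rewrite mulr_ge0// ltW.
have hii n (i : nat) : i%:R * h n <= i.+1%:R * h n.
  by rewrite ler_pM2r// ler_nat.
have mS (W : R -> Omega -> R) (HW : integrable_increasing P W) n :
    measurable_fun setT (fun w => (\sum_(i < n.+1) slope (M (i.+1%:R * h n) w) *
     (W (i.+1%:R * h n) w - W (i%:R * h n) w))%:E).
  apply/measurable_EFinP; apply: measurable_sum => i; apply: measurable_funM.
    exact: measurable_slopeM.
  by apply: measurable_funB; exact: (incr_measurable HW).
have S0 (W : R -> Omega -> R) (HW : integrable_increasing P W) n w :
    (0 <= (\sum_(i < n.+1) slope (M (i.+1%:R * h n) w) *
     (W (i.+1%:R * h n) w - W (i%:R * h n) w))%:E)%E.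
  rewrite lee_fin sumr_ge0// => i _; rewrite mulr_ge0//.
    by have /andP[] := slope_bound (M (i.+1%:R * h n) w).
  by rewrite subr_ge0 (incr_le HW)// hi hii.
have [mSU mSV] := (mS _ HU, mS _ HV); have [SU0 SV0] := (S0 _ HU, S0 _ HV).
have mphi : measurable_fun setT (fun w => (phi (M T w))%:E).
  apply/measurable_EFinP; apply: measurableT_comp (measurable_M T0').
  by apply: continuous_measurable_fun; exact: phi_continuous.
have mW (W : R -> Omega -> R) (HW : integrable_increasing P W) :
    measurable_fun setT (fun w => (W T w)%:E).
  by apply/measurable_EFinP; exact: (incr_measurable HW).
have W0 (W : R -> Omega -> R) (HW : integrable_increasing P W) w :
    (0 <= (W T w)%:E)%E by rewrite lee_fin (incr_ge0 HW).
have [mUT mVT] := (mW _ HU, mW _ HV); have [UT0 VT0] := (W0 _ HU, W0 _ HV).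
have fphi w : (0 <= (phi (M T w))%:E)%E by rewrite lee_fin phi_ge0.
set c := (\int[P]_w (phi (M T w))%:E)%E.
have c0 : (0 <= c)%E by exact: integral_ge0.
have EUV : (\int[P]_w (U T w)%:E = \int[P]_w (V T w)%:E)%E.
  rewrite -(doleans_setT HU T0') -(doleans_setT HV T0').
  by apply: (doleans_predictable_set HF) => //; exact: (@measurableT _
    (g_sigma_algebraType (predictable_rectangles F))).
have EV : (\int[P]_w (V T w)%:E)%E \is a fin_num.
  rewrite ge0_fin_numE; last by apply: integral_ge0 => w _; exact: W0.
  by rewrite -(doleans_setT HV T0'); exact: doleans_fin.
have ineq n : (c + \int[muV]_p (Hn n p)%:E <= \int[muU]_p (Hn n p)%:E)%E.
  have mphiU : measurable_fun setT (fun w => (phi (M T w))%:E + (U T w)%:E)%E.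
    exact: emeasurable_funD.
  have phiU0 w : (0 <= (phi (M T w))%:E + (U T w)%:E)%E by rewrite adde_ge0.
  (* The finite number [E[V T] = E[U T]] is added to both sides, which turns the claim into the
     expectation of [sum_slope_increments]. *)
  rewrite /muU /muV !integral_Hn -(leeD2rE _ _ EV) addeAC [leRHS]addeC -{1}EUV.
  rewrite -!ge0_integralD//.
  apply: ge0_le_integral => //.
  - by move=> w _; rewrite adde_ge0.
  - exact: emeasurable_funD.
  - exact: emeasurable_funD.
  - by move=> w _; rewrite -!EFinD lee_fin sum_slope_increments.
have eH : (\int[muV]_p (H p)%:E = \int[muU]_p (H p)%:E)%E.
  apply/esym/(doleans_predictable_integral HF) => //.
    exact/measurable_EFinP.
  by move=> p; rewrite lee_fin; have /andP[] := H_bound p.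
have mH : measurable_fun (setT : set (R * Omega)) H.
  by move=> _ B mB; apply: (predictable_set_measurable HF); exact: measurable_H.
have fH := integral_bounded_fin_num (doleans_fin HU T0') mH H_bound.
have c_eq0 : c = 0%E.
  apply/eqP; rewrite eq_le c0 andbT.
  have cU := @cvg_integral_Hn _ HU; have := @cvg_integral_Hn _ HV.
  rewrite -/muV eH => cV.
  apply: (cvge_shift_le cU cV fH _ ineq) => n.
  exact: (integral_bounded_fin_num (doleans_fin HV T0') (measurable_Hn n) (Hn_bound n)).
have := integral_eq0_ae (measurableT_comp (continuous_measurable_fun
  (@phi_continuous R)) (measurable_M T0')) (fun w => phi_ge0 _) c_eq0.
apply: filterS => w /phi_eq0/eqP.
by rewrite subr_eq0 => /eqP.
Qed.

End horizon.
(** One null set serves all positive rational times. Right-continuity does the rest: if [M t] were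
    nonzero, so would be [M] at some rational just after [t]. *)
Lemma increasing_eq : {ae P, forall w, forall t, 0 <= t -> U t w = V t w}.
Proof.
have rat_eq : {ae P, forall w, forall q : rat, 0 < (ratr q : R) ->
    U (ratr q) w = V (ratr q) w}.
  apply: ae_forall_count => q; have [q0|q0] := ltP 0 (ratr q : R).
    by apply: filterS (increasing_eq_at q0) => w ->.
  exact/nearW.
apply: filterS rat_eq => w rat_eq t t0; apply/eqP/negPn/negP => UVt.
have cM : (fun s => M s w) s @[s --> t^'+] --> M t w.
  by apply: cvgB; [exact: (incr_path HU w).1|exact: (incr_path HV w).1].
have : \forall s \near t^'+, M s w != 0.
  by apply: cvgr_neq0 cM _; rewrite subr_eq0.
move=> /near_right_ex[e e0 Mt].
have tte : t < t + e by rewrite ltrDl.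
have [q] := rat_in_itvoo tte; rewrite in_itv/= => tq.
by have := Mt _ tq; rewrite /M rat_eq ?subrr ?eqxx//; case/andP: tq => tq _; exact: le_lt_trans tq.
Qed.
End uniqueness.

(** * First passage of a single path *)

Section hitting_path.
Context {R : realType}.
Variable y : R -> R.
Hypothesis rc : forall t, 0 <= t -> y x @[x --> t^'+] --> y t.
Hypothesis lc : forall t, 0 < t -> cvg (y x @[x --> t^'-]).
Hypothesis y0 : y 0 < 0.
Local Notation hit := (ereal_inf [set t%:E | t in [set t : R | 0 <= t /\ 0 <= y t]]).
Hypothesis noleft : forall t, 0 <= t -> (t%:E < hit)%E ->
  sup [set y s | s in `[0, t]%classic] < 0.

(** Right-continuity again: a path negative on [[0, t]] stays negative a little beyond [t], so the
    infimum cannot be [t] without a contact by time [t]. *)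
Lemma hit_le t : 0 <= t ->
  (hit <= t%:E)%E <-> exists2 s, 0 <= s <= t & 0 <= y s.
Proof.
move=> t0; split=> [|[s /andP[s0 st] ys]]; last first.
  apply: (@le_trans _ _ s%:E); last by rewrite lee_fin.
  by apply: ereal_inf_lbound; exists s.
apply: contraPP => /forallPNP h.
have yneg s : 0 <= s <= t -> y s < 0.
  by move=> st; rewrite ltNge; apply/negP; exact: h.
have : \forall x \near t^'+, y x < 0.
  by apply: cvgr_lt (rc t0) _ _; apply: yneg; rewrite t0 lexx.
move=> /near_right_ex[e e0 ye]; apply/negP; rewrite -ltNge.
apply: (@lt_le_trans _ _ (t + e)%:E); first by rewrite lte_fin ltrDl.
apply/ereal_infP => _ [s [s0 ys] <-]; rewrite lee_fin leNgt; apply/negP => se.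
have [st|ts] := leP s t; first by have := yneg s; rewrite s0 st ltNge ys => /(_ isT).
by have := ye s; rewrite ts se ltNge ys => /(_ isT).
Qed.

Lemma hit_gt0 : (0 < hit)%E.
Proof.
rewrite ltNge; apply/negP => /(hit_le (lexx 0))[s].
by rewrite -eq_le => /eqP <-; rewrite leNgt y0.
Qed.

Lemma before_hit s : 0 <= s -> (s%:E < hit)%E -> y s < 0.
Proof.
move=> s0 sh; rewrite ltNge; apply/negP => ys.
by move: sh; rewrite ltNge => /negP; apply; apply/hit_le => //; exists s => //; rewrite s0 lexx.
Qed.

Lemma at_hit t : hit = t%:E -> 0 < t /\ 0 <= y t.
Proof.
move=> ht; have t0 : 0 < t by have := hit_gt0; rewrite ht lte_fin.
split=> //; have /(hit_le (ltW t0))[s /andP[s0 st] ys] : (hit <= t%:E)%E by rewrite ht.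
have : (hit <= s%:E)%E by apply/hit_le => //; exists s => //; rewrite s0 lexx.
by rewrite ht lee_fin => ts; rewrite (_ : t = s)//; apply/le_anti/andP.
Qed.

Lemma leftlimE t : 0 < t -> leftlim y t = lim (y x @[x --> t^'-]).
Proof. by move=> t0; rewrite /leftlim leNgt t0. Qed.

Lemma cvg_leftlim t : 0 < t -> y x @[x --> t^'-] --> leftlim y t.
Proof. by move=> t0; rewrite leftlimE//; exact: lc. Qed.

Lemma leftlim_hit_le0 t : hit = t%:E -> leftlim y t <= 0.
Proof.
move=> ht; have [t0 _] := at_hit ht; rewrite leftlimE//.
apply: limr_le; first exact: lc.
near=> x; apply/ltW/before_hit; last by rewrite ht lte_fin; near: x; exact: nbhs_left_lt.
by near: x; exact: nbhs_left_ge.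
Unshelve. all: by end_near. Qed.

Lemma before_hit_bound t : 0 <= t -> (t%:E < hit)%E ->
  exists2 e, 0 < e & forall s, 0 <= s <= t -> y s <= - e.
Proof.
move=> t0 /(noleft t0) Sneg; set S := [set _ | _ in _] in Sneg.
exists (- sup S); first by rewrite oppr_gt0.
move=> s st; rewrite opprK; apply: ub_le_sup; last by exists s.
(* A set without a supremum has [sup] equal to the default value 0, which the strict inequality
   excludes. *)
have [[]//|h] := pselect (has_sup S).
by move: Sneg; rewrite sup_out// ltxx.
Qed.

Lemma rat_near_hit (r t e : R) : 0 <= r -> r < t -> 0 <= y r -> 0 < e ->
  exists q : rat, r < ratr q < t /\ - e < y (ratr q).
Proof.
move=> r0 rt yr e0.
have : \forall x \near r^'+, - e < y x.
  by apply: cvgr_gt (rc r0) _ _; rewrite (lt_le_trans _ yr)// oppr_lt0.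
move=> /near_right_ex[c c0 yc].
have h : r < Num.min t (r + c) by rewrite lt_min rt ltrDl.
have [q] := rat_in_itvoo h; rewrite in_itv/= lt_min => /and3P[rq qt qc].
by exists q; rewrite rq qt yc// rq.
Qed.

(** Countably many values up to time [s] decide [hit <= s], which makes [tau] a stopping time.
    Rationals just after a contact at [r < s] give near-zero values; a contact at [s] leaves no such
    room, hence the first alternative. The converse rests on the uniform negative bound before the
    hit. *)
Lemma hit_le_rat s : 0 <= s -> (hit <= s%:E)%E <->
  0 <= y s \/ forall n : nat, exists q : rat,
    0 <= (ratr q : R) <= s /\ - n.+1%:R^-1 < y (ratr q).
Proof.
move=> s0; split=> [/(hit_le s0)[r /andP[r0 rs] yr]|[ys|h]].
- have [->|rNs] := eqVneq s r; first by left.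
  right => n.
  have rs' : r < s by rewrite lt_neqAle eq_sym rNs.
  have [q [/andP[rq qs] yq]] := rat_near_hit r0 rs' yr (e := n.+1%:R^-1) ltac:(by []).
  by exists q; rewrite (le_trans r0 (ltW rq)) ltW.
- by apply/(hit_le s0); exists s => //; rewrite s0 lexx.
- rewrite leNgt; apply/negP => /(before_hit_bound s0)[e e0 ye].
  have [n ne] : exists n, n.+1%:R^-1 < e.
    exists (Num.trunc e^-1); rewrite invf_plt ?posrE//.
    by rewrite truncnS_gt// invr_ge0 ltW.
  have [q [qs yq]] := h n.
  by have := lt_le_trans yq (ye _ qs); rewrite ltrN2 ltNge (ltW ne).
Qed.

(** Values near 0 strictly before the hit cannot stay within a compact interval before it, by the
    uniform bound; they must accumulate at the hit and force the left limit to be 0. *)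
Lemma left_hit_le_rat t :
  [/\ (hit < +oo)%E, leftlim y (fine hit) = 0 & (hit <= t%:E)%E] <->
  forall n : nat, exists q : rat, [/\ 0 <= (ratr q : R), ((ratr q)%:E < hit)%E,
    ratr q < t & - n.+1%:R^-1 < y (ratr q)].
Proof.
split=> [[hoo + ht] n|h].
  have [r hr] : exists r, hit = r%:E.
    move: hit hoo hit_gt0 ht => [r|//|//] _ _ _; by exists r.
  rewrite hr /= => lr; have [r0 _] := at_hit hr.
  have : \forall x \near r^'-, - n.+1%:R^-1 < y x.
    by apply: cvgr_gt (cvg_leftlim r0) _ _; rewrite lr oppr_lt0.
  move=> /near_left_ex[c c0 yc].
  have mr : Num.max 0 (r - c) < r by rewrite gt_max r0 ltrBlDr ltrDl.
  have [q] := rat_in_itvoo mr; rewrite in_itv/= gt_max => /andP[/andP[q0 rq] qr].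
  exists q; rewrite (ltW q0) lte_fin qr yc ?rq//; split=> //.
  by move: ht; rewrite hr lee_fin; exact: lt_le_trans.
have inv_lt (e : R) : 0 < e -> exists n : nat, n.+1%:R^-1 < e.
  move=> e0; exists (Num.trunc e^-1); rewrite invf_plt ?posrE//.
  by rewrite truncnS_gt// invr_ge0 ltW.
have t0 : 0 < t by have [q [q0 _ qt _]] := h 0%N; exact: le_lt_trans qt.
have ht : (hit <= t%:E)%E.
  rewrite leNgt; apply/negP => /(before_hit_bound (ltW t0))[e e0 ye].
  have [n ne] := inv_lt _ e0; have [q [q0 _ qt yq]] := h n.
  have := ye (ratr q); rewrite q0 (ltW qt) => /(_ isT) /(lt_le_trans yq).
  by rewrite ltrN2 ltNge (ltW ne).
have [r hr] : exists r, hit = r%:E.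
  by move: hit hit_gt0 ht => [r|//|//] _ _; exists r.
have [r0 _] := at_hit hr.
split=> //; first by rewrite hr ltry.
rewrite hr/=; apply/eqP; rewrite eq_le (leftlim_hit_le0 hr) leNgt; apply/negP => lr.
have : \forall x \near r^'-, y x < leftlim y r / 2.
  by apply: cvgr_lt (cvg_leftlim r0) _ _; lra.
move=> /near_left_ex[c c0 yc].
(* The cut [r - c / 2] lies strictly before the hit: up to it [y <= - e], and after it [y] is below
   half its negative left limit. A tolerance smaller than both bounds is contradictory. *)
have s0 : 0 <= Num.max 0 (r - c / 2) by rewrite le_max lexx.
have sh : ((Num.max 0 (r - c / 2))%:E < hit)%E.
  by rewrite hr lte_fin gt_max r0 ltrBlDr ltrDl divr_gt0.
have [e e0 ye] := before_hit_bound s0 sh.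
have [n ne] := inv_lt (Num.min e (- leftlim y r / 2)) ltac:(by rewrite lt_min e0/=; lra).
have [q [q0 qh _ yq]] := h n; move: ne qh; rewrite hr lte_fin lt_min => /andP[ne nl] qh.
have [qs|sq] := leP (ratr q) (Num.max 0 (r - c / 2)).
  have := ye (ratr q); rewrite q0 qs => /(_ isT) /(lt_le_trans yq).
  by rewrite ltrN2 ltNge (ltW ne).
move: sq; rewrite gt_max => /andP[_ sq].
have : y (ratr q) < leftlim y r / 2 by apply: yc; rewrite qh andbT; lra.
move: yq nl; set k := n.+1%:R^-1; lra.
Qed.

End hitting_path.

(** * Compensators *)

Section compensators.
Context {R : realType} {d : measure_display} {Omega : measurableType d}.
Context {P : probability Omega R} {F : R -> set (set Omega)}.
Hypothesis HF : usual_filtration P F.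
Implicit Types (A L U V : R -> Omega -> R).

Lemma compensator_predictable A L : compensator P F A L -> predictable F L.
Proof. by case=> -[]. Qed.

Lemma compensator_increasing A L :
  compensator P F A L -> integrable_increasing P L.
Proof.
case=> -[_ L0] cadL ndL iL _; split=> // w; split; last exact: ndL.
by move=> t t0; have [] := cadL w t t0.
Qed.

Lemma integral_EFinB (f g : Omega -> R) (B : set Omega) : measurable B ->
  P.-integrable setT (EFin \o f) -> P.-integrable setT (EFin \o g) ->
  (\int[P]_(w in B) (f w - g w)%:E =
   (\int[P]_(w in B) f w - \int[P]_(w in B) g w)%:E)%E.
Proof.
move=> mB iF iG.
have iB (k : Omega -> R) : P.-integrable setT (EFin \o k) -> P.-integrable B (EFin \o k).
  by apply: integrableS.
under eq_integral do rewrite EFinB.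
rewrite integralB_EFin ?iB// EFinB /Rintegral !fineK//.
  exact: integrable_fin_num (iB _ iG).
exact: integrable_fin_num (iB _ iF).
Qed.

(** All integrals involved are finite, so the martingale identity for [A - L] can be rearranged into
    an equality of increments. *)
Lemma compensator_same_increments A L : integrable_increasing P A ->
  compensator P F A L -> same_increments P F A L.
Proof.
move=> HA HL; have iL := incr_integrable (compensator_increasing HL).
have iA := incr_integrable HA; case: HL => _ _ _ _ mart s t B st FB.
have /andP[s0 st'] := st; have t0 := le_trans s0 st'.
have mB := filtration_measurable HF s0 FB.
move: (mart s t B st FB); rewrite !integral_EFinB ?iA ?iL//.
by move=> -[e]; congr EFin; lra.
Qed.

Lemma same_increments_sym U V :
  same_increments P F U V -> same_increments P F V U.
Proof. by move=> UV s t B st FB; rewrite UV. Qed.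

Lemma same_increments_trans U V W : same_increments P F U V ->
  same_increments P F V W -> same_increments P F U W.
Proof. by move=> UV VW s t B st FB; rewrite UV// VW. Qed.

Lemma increasingD U V : integrable_increasing P U -> integrable_increasing P V ->
  integrable_increasing P (fun t w => U t w + V t w).
Proof.
move=> HU HV; split.
- move=> w; split=> [t t0|s t st].
    by apply: cvgD; [exact: (incr_path HU w).1|exact: (incr_path HV w).1].
  by apply: lerD; [exact: (incr_le HU)|exact: (incr_le HV)].
- by move=> w; rewrite (incr0 HU) (incr0 HV) addr0.
- move=> t t0; have := integrableD measurableT (incr_integrable HU t0)
    (incr_integrable HV t0).
  by apply: eq_integrable => // w _; rewrite /= EFinD.
Qed.

Lemma same_incrementsD U V U' V' :
  integrable_increasing P U -> integrable_increasing P V ->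
  integrable_increasing P U' -> integrable_increasing P V' ->
  same_increments P F U U' -> same_increments P F V V' ->
  same_increments P F (fun t w => U t w + V t w) (fun t w => U' t w + V' t w).
Proof.
move=> HU HV HU' HV' eU eV s t B st FB.
have /andP[s0 st'] := st; have t0 := le_trans s0 st'.
have mB := filtration_measurable HF s0 FB.
have iB W r : integrable_increasing P W -> 0 <= r ->
    P.-integrable B (EFin \o W r).
  by move=> HW r0; apply: integrableS (incr_integrable HW r0).
have E W1 W2 : integrable_increasing P W1 -> integrable_increasing P W2 ->
    (\int[P]_(w in B) (W1 t w + W2 t w - (W1 s w + W2 s w))%:E =
    \int[P]_(w in B) (W1 t w - W1 s w)%:E + \int[P]_(w in B) (W2 t w - W2 s w)%:E)%E.
  move=> HW1 HW2.
  rewrite (integral_EFinB mB (incr_integrable (increasingD HW1 HW2) t0)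
    (incr_integrable (increasingD HW1 HW2) s0)).
  rewrite !integral_EFinB ?(incr_integrable HW1) ?(incr_integrable HW2)//.
  rewrite !RintegralD ?iB// -EFinD; congr EFin; lra.
by rewrite !E// eU// eV.
Qed.

Lemma predictableD U V : predictable F U -> predictable F V ->
  predictable F (fun t w => U t w + V t w).
Proof.
by move=> /(predictableP HF) mU /(predictableP HF) mV; apply/(predictableP HF);
  exact: measurable_funD.
Qed.

Lemma ind_proc_increasing (sigma : Omega -> \bar R) :
  (forall w, (0 < sigma w)%E) ->
  (forall t, 0 <= t -> measurable [set w | (sigma w <= t%:E)%E]) ->
  integrable_increasing P (ind_proc sigma).
Proof.
move=> sigma0 msigma; split.
- move=> w; split=> [t t0|s t /andP[s0 st]]; last first.
    rewrite /ind_proc ler_nat; case: (boolP (sigma w <= s%:E)%E) => // ss.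
    by rewrite (le_trans ss).
  apply: (@cvg_near_cst _ _ _ _ _ _).
  have [st|] := leP (sigma w) t%:E.
    near=> x; rewrite /ind_proc st (le_trans st)// lee_fin.
    by near: x; exact: nbhs_right_ge.
  rewrite /ind_proc => ts; rewrite leNgt ts /=.
  have [e te] : exists2 e, t < e & (e%:E <= sigma w)%E.
    move: (sigma w) ts => [r|_|//]; first by exists r.
    by exists (t + 1); rewrite ?leey// ltrDl.
  move=> es; near=> x; rewrite leNgt (lt_le_trans _ es)// lte_fin.
  by near: x; exact: nbhs_right_lt.
- by move=> w; rewrite /ind_proc leNgt sigma0.
- move=> t t0.
  have mA : measurable_fun setT (EFin \o ind_proc sigma t).
    apply/measurable_EFinP.
    rewrite (_ : ind_proc sigma t = \1_[set w | (sigma w <= t%:E)%E]).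
      by apply: measurable_indic; exact: msigma.
    by apply/funext => w; rewrite indicE mem_setE.
  apply: (le_integrable measurableT mA (g := EFin \o cst 1)); last first.
    exact: finite_measure_integrable_cst.
  by move=> w _; rewrite /= lee_fin !ger0_norm// /ind_proc lern1 leq_b1.
Unshelve. all: by end_near. Qed.

Lemma predictable_ind_proc (sigma : Omega -> \bar R) :
  predictable_set F [set p | 0 <= p.1 /\ (sigma p.2 <= p.1%:E)%E] ->
  predictable F (ind_proc sigma).
Proof.
move=> psigma; apply/(predictableP HF).
pose S : set (g_sigma_algebraType (predictable_rectangles F)) :=
  [set p | 0 <= p.1 /\ (sigma p.2 <= p.1%:E)%E].
have mS : measurable S := psigma.
refine (eq_measurable_fun (\1_S : _ -> R) _ (measurable_indic mS)).
move=> p; rewrite inE/= => p0; rewrite indicE /ind_proc.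
by congr (nat_of_bool _)%:R; apply/idP/idP => [|h]; rewrite inE => // -[].
Qed.

(** Every jump gap contains a rational level, and every time lies below an integer horizon, so a
    countable union of null sets excludes all jumps at once. *)
Lemma jumps_null_continuous L (HL : integrable_increasing P L) :
  predictable F L -> (forall w, cadlag (L ^~ w)) ->
  (forall T (T0 : 0 <= T) a, 0 < a -> doleans_measure HL T0
    [set p | [/\ 0 <= p.1, a <= L p.1 p.2 &
      forall s, 0 <= s < p.1 -> L s p.2 < a]] = 0%E) ->
  {ae P, forall w, {within `[0, +oo[%classic, continuous (L ^~ w)}}.
Proof.
move=> pL cadL L0.
have T0 (n : nat) : 0 <= n%:R :> R by [].
pose S (a : R) := [set p : R * Omega | [/\ 0 <= p.1, a <= L p.1 p.2 &
      forall s, 0 <= s < p.1 -> L s p.2 < a]].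
have : {ae P, forall w, forall n (q : rat), 0 < (ratr q : R) -> forall x y : R, x < y ->
    ~ (forall u, x < u <= y -> time_change_dom L n%:R (w, u) /\
       S (ratr q) (time_change L n%:R (w, u)))}.
  apply: ae_foralln => n; apply: ae_forall_count => q.
  have [q0|q0] := ltP 0 (ratr q : R); last exact/nearW.
  have mS : measurable (S (ratr q)).
    apply: (predictable_set_measurable HF); apply: (predictable_time_entry HF) => //.
    by move=> w s t st; exact: (incr_le HL).
  have := doleans_eq0_ae mS (L0 _ (T0 n) _ q0).
  by apply: filterS => w h _; exact: h.
apply: filterS => w Lw; apply/continuous_within_itvcyP; split; last first.
  by have [] := cadL w 0 (lexx _).
move=> r; rewrite in_itv/= andbT => r0.
have [Lr /(_ r0) Ll] := cadL w r (ltW r0).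
set l := lim (L x w @[x --> r^'-]) in Ll.
have cl : L x w @[x --> r^'-] --> l by exact: Ll.
have Lle s : 0 <= s < r -> L s w <= l.
  move=> /andP[s0 sr]; apply: limr_ge => //; near=> x.
  apply: (incr_le HL); rewrite s0/=; near: x; exact: nbhs_left_ge.
have lr : l <= L r w.
  apply: limr_le => //; near=> x; apply: (incr_le HL).
  apply/andP; split; near: x; first exact: nbhs_left_ge.
  exact: nbhs_left_le.
suff lE : l = L r w.
  by apply/left_right_continuousP; split=> //; rewrite -lE.
apply/eqP; rewrite eq_le lr leNgt; apply/negP => llr.
have l0 : 0 <= l by rewrite -(incr0 HL w); apply: Lle; rewrite lexx.
have [q] := rat_in_itvoo llr; rewrite in_itv/= => /andP[lq qr].
pose n := (Num.trunc r).+1.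
have rn : r < n%:R by rewrite truncnS_gt// ltW.
(* The path skips all levels in []l, q]], so each of them is first hit at [r], which is also the
   entry time of level [q]: an interval of levels is sent into the null graph. *)
apply: (Lw n q (le_lt_trans l0 lq) _ _ lq) => u /andP[lu uq].
have ur : u <= L r w by rewrite (le_trans uq)// ltW.
have fh : first_hit (L ^~ w) n%:R u = r.
  apply/eqP; rewrite eq_le first_hit_le ?(ltW r0)//; last exact: (incr_path HL w).
  rewrite ur/= leNgt; apply/negP => fr.
  have f0 : 0 <= first_hit (L ^~ w) n%:R u by exact: first_hit_ge0.
  have := lexx (first_hit (L ^~ w) n%:R u).
  rewrite {1}first_hit_le//; last exact: (incr_path HL w).
  move=> /orP[uf|nf]; last by move: (le_lt_trans nf fr); rewrite ltNge ltW.
  have := Lle (first_hit (L ^~ w) n%:R u); rewrite f0 fr => /(_ isT) fl.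
  by move: (le_lt_trans (le_trans uf fl) lu); rewrite ltxx.
split.
  rewrite /time_change_dom/= (le_lt_trans l0 lu)/= (le_trans ur)//.
  by apply: (incr_le HL); rewrite !ltW.
rewrite /S /time_change/= fh; split; [exact: ltW|exact: ltW|].
by move=> s sr; exact: le_lt_trans (Lle _ sr) lq.
Unshelve. all: by end_near. Qed.

End compensators.

(** * First passage over the barrier *)

Section first_passage.
Context {R : realType} {d : measure_display} {Omega : measurableType d}.
Context {P : probability Omega R} {F : R -> set (set Omega)}.
Context {X : R -> Omega -> R} {b : R -> R}.
Hypothesis HF : usual_filtration P F.
Hypothesis HXad : adapted F X.
Hypothesis HXcadlag : forall w, cadlag (X ^~ w).
Hypothesis Hbcont : {within `[0, +oo[%classic, continuous b}.
Hypothesis HX0 : forall w, X 0 w < b 0.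
Hypothesis Hnoleft : forall t, 0 <= t -> forall w, (t%:E < tau X b w)%E ->
  sup [set Yp X b s w | s in `[0, t]%classic] < 0.

Lemma barrier_cvg_left t : 0 < t -> b x @[x --> t^'-] --> b t.
Proof.
have [bc _] := (continuous_within_itvcyP _ _).1 Hbcont.
by move=> t0; apply: cvg_at_left_filter; apply: bc; rewrite in_itv/= t0.
Qed.

Lemma barrier_cvg_right t : 0 <= t -> b x @[x --> t^'+] --> b t.
Proof.
have [bc b0] := (continuous_within_itvcyP _ _).1 Hbcont.
rewrite le_eqVlt => /orP[/eqP <-//|t0].
by apply: cvg_at_right_filter; apply: bc; rewrite in_itv/= t0.
Qed.

Let Y_rc w t : 0 <= t -> Yp X b x w @[x --> t^'+] --> Yp X b t w.
Proof.
move=> t0; apply: cvgB; last exact: barrier_cvg_right.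
by have [] := HXcadlag w t0.
Qed.

Lemma cvg_left_Yp w t : 0 < t ->
  Yp X b x w @[x --> t^'-] --> leftlim (X ^~ w) t - b t.
Proof.
move=> t0; apply: cvgB; last exact: barrier_cvg_left.
rewrite /leftlim leNgt t0 /=.
by have [_ /(_ t0)] := HXcadlag w (ltW t0).
Qed.

Let Y_lc w t : 0 < t -> cvg (Yp X b x w @[x --> t^'-]).
Proof. by move=> t0; apply/cvg_ex; eexists; exact: cvg_left_Yp. Qed.

(** Continuity of [b] converts the sign of the left limit of [Y], which defines [Gset], into the
    comparison of the left limit of [X] with [b] used in hypothesis (b). *)
Lemma leftlim_Yp w t : 0 < t ->
  leftlim (Yp X b ^~ w) t = leftlim (X ^~ w) t - b t.
Proof.
move=> t0; rewrite [LHS]/leftlim leNgt t0 /=.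
by apply: cvg_lim => //; exact: cvg_left_Yp.
Qed.

Let Y0 w : Yp X b 0 w < 0.
Proof. by rewrite /Yp subr_lt0. Qed.

Let noleft w t : 0 <= t -> (t%:E < tau X b w)%E ->
  sup [set Yp X b s w | s in `[0, t]%classic] < 0.
Proof. by move=> t0; exact: Hnoleft. Qed.

Lemma tau_gt0 w : (0 < tau X b w)%E.
Proof. exact: (hit_gt0 (@Y_rc w) (Y0 w)). Qed.

Lemma tau_at w t : tau X b w = t%:E -> 0 < t /\ 0 <= Yp X b t w.
Proof. exact: (at_hit (@Y_rc w) (Y0 w)). Qed.

Lemma tauL_gt0 w : (0 < tauL X b w)%E.
Proof. by rewrite /tauL; case: ifPn => // _; exact: tau_gt0. Qed.

Lemma tauG_gt0 w : (0 < tauG X b w)%E.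
Proof. by rewrite /tauG; case: ifPn => // _; exact: tau_gt0. Qed.

Lemma adapted_gt q c : 0 <= q -> F q [set w | c < Yp X b q w].
Proof.
move=> q0; have := HXad q0 (measurable_itv `]c + b q, +oo[).
by congr F; apply/seteqP; split=> w; rewrite /Yp /= inE/= in_itv/= andbT ltrBrDr.
Qed.

Lemma adapted_ge q c : 0 <= q -> F q [set w | c <= Yp X b q w].
Proof.
move=> q0; have := HXad q0 (measurable_itv `[c + b q, +oo[).
by congr F; apply/seteqP; split=> w; rewrite /Yp /= inE/= in_itv/= andbT lerBrDr.
Qed.

Lemma stopping_tau t : 0 <= t -> F t [set w | (tau X b w <= t%:E)%E].
Proof.
move=> t0.
rewrite (_ : [set w | _] = [set w | 0 <= Yp X b t w] `|`
  \bigcap_n \bigcup_q (if 0 <= (ratr q : R) <= t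
    then [set w | - n.+1%:R^-1 < Yp X b (ratr q) w] else set0)).
  apply: (filtrationU HF) => //; first exact: adapted_ge.
  apply: (filtration_bigcap HF) => // n; apply: (filtration_bigcup_rat HF) => // q.
  case: ifPn => [qt|_]; last exact: (filtration0 HF).
  apply: (filtration_le HF qt); apply: adapted_gt.
  by case/andP: qt.
apply/seteqP; split=> w /=.
  move=> /(hit_le_rat (@Y_rc w) (@noleft w) t0)[|h]; [by left|right=> n _].
  by have [q [qt yq]] := h n; exists q => //; rewrite qt.
move=> h; apply/(hit_le_rat (@Y_rc w) (@noleft w) t0).
case: h => [|h]; [by left|right=> n].
by have [q _] := h n Logic.I; case: ifPn => // qt yq; exists q.
Qed.

Lemma tauL_leP w t : (tauL X b w <= t%:E)%E <->
  Lset X b w /\ (tau X b w <= t%:E)%E.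
Proof.
rewrite /tauL; case: ifPn => [/asboolP Lw|/asboolP Lw]; split=> //; first by case.
by case.
Qed.

Lemma tauG_leP w t : (tauG X b w <= t%:E)%E <->
  Gset X b w /\ (tau X b w <= t%:E)%E.
Proof.
rewrite /tauG; case: ifPn => [/asboolP Gw|/asboolP Gw]; split=> //; first by case.
by case.
Qed.

(** The condition of [left_hit_le_rat] is decided at rational times strictly before [t], so it is a
    countable combination of sets []q, +oo[ x B] with [B] in [F q]; the strictness gives
    predictability rather than mere adaptedness. *)
Lemma predictable_tauL :
  predictable_set F [set p | 0 <= p.1 /\ (tauL X b p.2 <= p.1%:E)%E].
Proof.
pose B n q := [set w | - n.+1%:R^-1 < Yp X b (ratr q) w] `&`
    ~` [set w | (tau X b w <= (ratr q)%:E)%E].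
pose E n q : set (R * Omega) :=
  if 0 <= (ratr q : R) then [set p | ratr q < p.1 /\ B n q p.2] else set0.
rewrite (_ : [set p | _] = \bigcap_n \bigcup_(q : rat) E n q).
  apply: (@bigcapT_measurable _ (g_sigma_algebraType (predictable_rectangles F))) => n.
  apply: (@bigcupT_measurable_rat _ (g_sigma_algebraType (predictable_rectangles F))) => q.
  rewrite /E; case: ifPn => [q0|_]; last exact: measurable0.
  apply: (predictable_set_after q0 (B := B n q)).
  apply: (filtrationI HF) => //; first exact: adapted_gt.
  by apply: (filtrationC HF) => //; exact: stopping_tau.
have LE w t := left_hit_le_rat (@Y_rc w) (@Y_lc w) (Y0 w) (@noleft w) t.
apply/seteqP; split=> [[t w] /= [t0 /tauL_leP[[h1 h2] h3]] n _|[t w] /= h].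
  have [q [q0 qtau qt yq]] := (LE w t).1 (And3 h1 h2 h3) n.
  exists q => //; rewrite /E q0; split=> //; split=> //=.
  by apply/negP; rewrite -ltNge.
have {}h n : exists q : rat, [/\ 0 <= (ratr q : R), ((ratr q)%:E < tau X b w)%E,
    ratr q < t & - n.+1%:R^-1 < Yp X b (ratr q) w].
  have [q _] := h n Logic.I; rewrite /E; case: ifPn => // q0 [/= qt [yq /negP]].
  by rewrite -ltNge => qtau; exists q.
split.
  by have [q [q0 _ qt _]] := h 0%N; rewrite (le_trans q0)// ltW.
by have [h1 h2 h3] := (LE w t).2 h; apply/tauL_leP.
Qed.

(** The left limit of [Y] at [tau] is never positive, so [Lset] and [Gset] partition the event that
    [tau] is finite. *)
Lemma ind_proc_tau t w : ind_proc (tau X b) t w =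
  ind_proc (tauL X b) t w + ind_proc (tauG X b) t w.
Proof.
rewrite /ind_proc -natrD; congr (_%:R).
have LG : Lset X b w -> ~ Gset X b w by move=> [_ h] [_]; rewrite h ltxx.
have [ht|ht] := boolP (tau X b w <= t%:E)%E; last first.
  have -> : (tauL X b w <= t%:E)%E = false.
    by apply/negP => /tauL_leP[_]; apply/negP.
  suff -> : (tauG X b w <= t%:E)%E = false by [].
  by apply/negP => /tauG_leP[_]; apply/negP.
have [r hr] : exists r, tau X b w = r%:E.
  by move: (tau X b w) (tau_gt0 w) ht => [r|//|//] _ _; exists r.
have := leftlim_hit_le0 (@Y_rc w) (@Y_lc w) (Y0 w) hr.
rewrite le_eqVlt => /orP[/eqP lr|lr].
  have Lw : Lset X b w by split; rewrite hr ?ltry.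
  have -> : (tauL X b w <= t%:E)%E by apply/tauL_leP.
  suff -> : (tauG X b w <= t%:E)%E = false by [].
  by apply/negP => /tauG_leP[Gw _]; exact: LG Gw.
have Gw : Gset X b w by split; rewrite hr ?ltry.
have -> : (tauG X b w <= t%:E)%E by apply/tauG_leP.
suff -> : (tauL X b w <= t%:E)%E = false by [].
by apply/negP => /tauL_leP[Lw _]; exact: LG Gw.
Qed.

Lemma measurable_tau t : 0 <= t -> measurable [set w | (tau X b w <= t%:E)%E].
Proof. by move=> t0; apply: (filtration_measurable HF t0); exact: stopping_tau. Qed.

Lemma measurable_tauL t : 0 <= t -> measurable [set w | (tauL X b w <= t%:E)%E].
Proof.
move=> t0; apply: (filtration_measurable HF t0).
have := predictable_set_section HF t0 predictable_tauL.
by congr F; apply/seteqP; split=> w /= => [[]|].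
Qed.

Lemma measurable_tauG t : 0 <= t -> measurable [set w | (tauG X b w <= t%:E)%E].
Proof.
move=> t0; rewrite (_ : [set w | _] =
  [set w | (tau X b w <= t%:E)%E] `\` [set w | (tauL X b w <= t%:E)%E]).
  by apply: measurableD; [exact: measurable_tau|exact: measurable_tauL].
apply/seteqP; split=> w /=; have := ind_proc_tau t w; rewrite /ind_proc -natrD.
  move=> /eqP; rewrite eqr_nat => + h; rewrite h.
  by case: (tau X b w <= t%:E)%E; case: (tauL X b w <= t%:E)%E.
move=> /eqP; rewrite eqr_nat => + [h /negP/negbTE h']; rewrite h h'.
by case: (tauG X b w <= t%:E)%E.
Qed.

Lemma tau_increasing : integrable_increasing P (ind_proc (tau X b)).
Proof. by apply: ind_proc_increasing; [exact: tau_gt0|exact: measurable_tau]. Qed.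

Lemma tauL_increasing : integrable_increasing P (ind_proc (tauL X b)).
Proof. by apply: ind_proc_increasing; [exact: tauL_gt0|exact: measurable_tauL]. Qed.

Lemma tauG_increasing : integrable_increasing P (ind_proc (tauG X b)).
Proof. by apply: ind_proc_increasing; [exact: tauG_gt0|exact: measurable_tauG]. Qed.

Hypothesis Hpred : forall sigma : Omega -> \bar R, predictable_time F sigma ->
  P.-negligible [set w | (sigma w < +oo)%E /\
    leftlim (X ^~ w) (fine (sigma w)) < b (fine (sigma w))
    <= X (fine (sigma w)) w].

(** The level is subtracted from the process so that [hit_le] applies. By monotonicity the time is
    at most [t] exactly when [a <= L t], a predictable condition. *)
Lemma predictable_time_level L a : integrable_increasing P L -> predictable F L ->
  predictable_time F (fun w =>
    ereal_inf [set t%:E | t in [set t : R | 0 <= t /\ 0 <= L t w - a]]).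
Proof.
move=> HL pL; split=> [w|]; first by apply/ereal_infP => _ [t [t0 _] <-].
rewrite (_ : [set p | _] = [set p | 0 <= p.1 /\ L p.1 p.2 \in `[a, +oo[%classic]).
  by apply: pL; exact: measurable_itv.
have rc w t : 0 <= t -> L x w - a @[x --> t^'+] --> L t w - a.
  by move=> t0; apply: cvgB; [exact: (incr_path HL w).1|exact: cvg_cst].
apply/seteqP; split=> [[t w] /= [t0]|[t w] /= [t0]].
  move=> /(hit_le (@rc w) t0)[s st] /=; rewrite subr_ge0 => aL; split=> //.
  by rewrite inE/= in_itv/= andbT (le_trans aL)// (incr_le HL).
rewrite inE/= in_itv/= andbT => aL; split=> //; apply/(hit_le (@rc w) t0).
by exists t; rewrite ?t0 ?lexx ?subr_ge0.
Qed.

(** The measure of [A^G] charges only the instant [tauG]. Where this lies on the graph of the entry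
    time of level [a], a predictable time, the path jumps over the barrier there, and hypothesis (b)
    makes such paths negligible. *)
Lemma doleans_tauG_entry L a T (T0 : 0 <= T) :
  integrable_increasing P L -> predictable F L ->
  doleans_measure tauG_increasing T0 [set p | [/\ 0 <= p.1, a <= L p.1 p.2 &
    forall s, 0 <= s < p.1 -> L s p.2 < a]] = 0%E.
Proof.
move=> HL pL; set S := [set p | _].
have mS : measurable S.
  apply: (predictable_set_measurable HF); apply: (predictable_time_entry HF) => //.
  by move=> w s t st; exact: (incr_le HL).
have pa := predictable_time_level a HL pL.
apply: (doleans_null tauG_increasing T0 mS (Hpred pa)).
move=> [w u]; rewrite /time_change_dom /time_change /= => /andP[u0 uT].
set r := first_hit _ _ _ => -[r0 aLr Lsa].
have rcG := incr_path tauG_increasing w.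
have fh s : 0 <= s -> (r <= s) = (u <= ind_proc (tauG X b) s w) || (T <= s).
  by move=> s0; rewrite /r first_hit_le.
(* The process takes only the values 0 and 1, so a positive level [u] is first reached at [tauG];
   this claim and the next identify [tauG] with [r]. *)
have Gr : (tauG X b w <= r%:E)%E.
  have ur : u <= ind_proc (tauG X b) r w.
    have := lexx r; rewrite {1}fh// => /orP[//|Tr].
    by apply: (le_trans uT); apply: rcG.2; rewrite T0.
  by move: (lt_le_trans u0 ur); rewrite /ind_proc ltr0n lt0b.
have Gs s : 0 <= s < r -> ~~ (tauG X b w <= s%:E)%E.
  move=> /andP[s0 sr]; apply/negP => Gs; move: sr; rewrite ltNge fh//.
  rewrite {1}/ind_proc Gs (le_trans uT)//.
  by rewrite /ind_proc lern1 leq_b1.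
have [[tauoo lG] taur] := (tauG_leP _ _).1 Gr.
have [h hE] : exists h, tau X b w = h%:E.
  by move: (tau X b w) (tau_gt0 w) taur => [h|//|//] _ _; exists h.
have [h0 Yh] := tau_at hE.
have hr : h = r.
  move: taur; rewrite hE lee_fin le_eqVlt => /orP[/eqP//|hr].
  have : ~~ (tauG X b w <= h%:E)%E by apply: Gs; rewrite hr ltW.
  by move=> /negP; case; apply/tauG_leP; rewrite hE lexx.
move: lG; rewrite hE /= leftlim_Yp// => lG.
set sigma := ereal_inf _.
(* On the graph, the predictable time attached to level [a] takes the value [r], so hypothesis (b)
   speaks about the crossing time. *)
have -> : sigma = r%:E.
  apply/eqP; rewrite eq_le; apply/andP; split.
    by apply: ereal_inf_lbound; exists r => //=; rewrite subr_ge0.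
  apply/ereal_infP => _ [t [t0 aLt] <-]; rewrite /= subr_ge0 in aLt.
  by rewrite lee_fin leNgt; apply/negP => tr; move: (Lsa t); rewrite t0 tr ltNge aLt => /(_ isT).
rewrite -hr /= ltry; split=> //; apply/andP; split; first by rewrite -subr_lt0.
by move: Yh; rewrite /Yp subr_ge0.
Qed.

End first_passage.

(** * Decomposition of the compensator into its two parts *)

Theorem theorem2p19 (R : realType) (d : measure_display) (Omega : measurableType d)
  (P : probability Omega R) (F : R -> set (set Omega))
  (X : R -> Omega -> R) (b : R -> R)
  (HF : usual_filtration P F)
  (HXad : adapted F X)
  (HXcadlag : forall w, cadlag (X ^~ w))
  (Hbcont : {within `[0, +oo[%classic, continuous b})
  (HX0 : forall w, X 0 w < b 0)
  (* (a) no premature left contact *)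
  (Hnoleft : forall t, 0 <= t -> forall w, (t%:E < tau X b w)%E ->
     sup [set Yp X b s w | s in `[0, t]%classic] < 0)
  (* (b) no predictable crossing *)
  (Hpred : forall sigma : Omega -> \bar R, predictable_time F sigma ->
     P.-negligible [set w | (sigma w < +oo)%E /\
        leftlim (X ^~ w) (fine (sigma w)) < b (fine (sigma w))
        <= X (fine (sigma w)) w])
  (Lambda LambdaL LambdaG : R -> Omega -> R)
  (HLam : compensator P F (ind_proc (tau X b)) Lambda)
  (HLamL : compensator P F (ind_proc (tauL X b)) LambdaL)
  (HLamG : compensator P F (ind_proc (tauG X b)) LambdaG) :
  [/\ (forall t w, 0 <= t ->
         ind_proc (tau X b) t w = ind_proc (tauL X b) t w + ind_proc (tauG X b) t w),
      {ae P, forall w, forall t, 0 <= t -> Lambda t w = LambdaL t w + LambdaG t w},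
      {ae P, forall w, forall t, 0 <= t -> LambdaL t w = ind_proc (tauL X b) t w} &
      {ae P, forall w, {within `[0, +oo[%classic, continuous (LambdaG ^~ w)}}].
Proof.
have iA := tau_increasing HF HXad HXcadlag Hbcont HX0 Hnoleft.
have iAL := tauL_increasing HF HXad HXcadlag Hbcont HX0 Hnoleft.
have iAG := tauG_increasing HF HXad HXcadlag Hbcont HX0 Hnoleft.
have [iL iLL iLG] := And3 (compensator_increasing HLam)
  (compensator_increasing HLamL) (compensator_increasing HLamG).
have [pL pLL pLG] := And3 (compensator_predictable HLam)
  (compensator_predictable HLamL) (compensator_predictable HLamG).
have sL := compensator_same_increments HF iA HLam.
have sLL := compensator_same_increments HF iAL HLamL.
have sLG := compensator_same_increments HF iAG HLamG.
have AE t w := ind_proc_tau HXcadlag Hbcont HX0 t w.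
split.
- by move=> t w _; exact: AE.
(* Both sides are predictable and have the same increments as [A], so uniqueness applies. *)
- apply: (increasing_eq HF iL (increasingD iLL iLG) pL (predictableD HF pLL pLG)).
  apply: (same_increments_trans (same_increments_sym sL)).
  have -> : ind_proc (tau X b) =
      (fun t w => ind_proc (tauL X b) t w + ind_proc (tauG X b) t w).
    by apply/funext => t; apply/funext => w; exact: AE.
  exact: (same_incrementsD HF iAL iAG iLL iLG sLL sLG).
(* Here [A^L] is itself predictable, hence a second candidate with the increments of [LambdaL]. *)
- apply: (increasing_eq HF iLL iAL pLL).
    apply: (predictable_ind_proc HF).
    exact: (predictable_tauL HF HXad HXcadlag Hbcont HX0 Hnoleft).
  exact: same_increments_sym sLL.
- have cLG w : cadlag (LambdaG ^~ w) by case: HLamG.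
  apply: (jumps_null_continuous HF (HL := iLG)) => // T T0 a a0.
  have pS : predictable_set F [set p | [/\ 0 <= p.1, a <= LambdaG p.1 p.2 &
      forall s, 0 <= s < p.1 -> LambdaG s p.2 < a]].
    apply: (predictable_time_entry HF) => // w s t st.
    exact: (incr_le iLG).
  (* The graph is predictable, so its mass may be computed with [A^G] in place of [LambdaG]. *)
  rewrite -(doleans_predictable_set HF iAG iLG T0 sLG pS).
  by rewrite -(doleans_tauG_entry HF HXad HXcadlag Hbcont HX0 Hnoleft Hpred a T0 iLG pLG).
Qed.
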